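(* Let $v_0>0$ and $0\le {\rm M}_-\le {\rm M}_+$ with $({\rm M}_-,{\rm M}_+)\neq(0,0)$. Let $\tau_+,\tau_-$ be the Jacobi periods of the planar Euler problem and $\omega(d,f):=\tau_-(d,f)/\tau_+(d,f)$ the rotation number, all defined for $(d,f)\in{\mathbb P}$. For every $d>0$, let ${\mathbb P}_d:=\{f\in{\mathbb R}:(d,f)\in{\mathbb P}\}$. Then the functions $\tau_-(d,\cdot)$, $\tau_+(d,\cdot)$ and $\omega(d,\cdot)$ are differentiable and monotone on each connected component of ${\mathbb P}_d$.
   Context: Setting: the planar Euler (two fixed centers) problem with masses $M\ge m\ge0$, $(M,m)\ne(0,0)$, located at $-v_0\,\mathbf i$ and $v_0\,\mathbf i$ ($v_0>0$), and ${\rm M}_-=M-m$, ${\rm M}_+=M+m$. In confocal coordinates $\alpha\ge1$, $|\beta|\le1$ and Jacobi's regularized time $\tau$, the planar motions with energy ${\rm J}_0<0$ and separation constant ${\rm F}_0$ satisfy $(\alpha')^2=W_+(\alpha)$, $(\beta')^2=W_-(\beta)$ (prime is $d/d\tau$) with $$W_+(\alpha)=(\alpha^2-1)\big(2{\rm J}_0v_0^2\alpha^2+2{\rm M}_+v_0\alpha-(2{\rm J}_0v_0^2+{\rm F}_0)\big),\qquad W_-(\beta)=(1-\beta^2)\big(-2{\rm J}_0v_0^2\beta^2-2{\rm M}_-v_0\beta+(2{\rm J}_0v_0^2+{\rm F}_0)\big).$$ Parameters: $d:=-4v_0{\rm J}_0$ and $f:=-2{\rm J}_0{\rm F}_0$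 (so, for $d>0$, ${\rm J}_0=-d/(4v_0)$ and ${\rm F}_0=2v_0f/d$). Jacobi periods: $$\tau_+(d,f)=2\int_{\alpha_{\min}}^{\alpha_{\max}}\frac{d\alpha}{\sqrt{W_+(\alpha)}},\qquad \tau_-(d,f)=2\int_{\beta_{\min}}^{\beta_{\max}}\frac{d\beta}{\sqrt{W_-(\beta)}},$$ where $[\alpha_{\min},\alpha_{\max}]$ is the nondegenerate interval of $\{\alpha\ge1: W_+(\alpha)\ge0\}$ and $[\beta_{\min},\beta_{\max}]$ is a nondegenerate connected component of $\{\beta\in[-1,1]: W_-(\beta)\ge0\}$ (when there are two such components they give the same value of $\tau_-$). For ${\rm M}\ge0$ and $d>0$ put $$f^-_{\rm M}(d)=-{\rm M}d,\quad f^{\rm s}_{\rm M}(d)=\begin{cases}{\rm M}d&0<d\le2{\rm M}\\ {\rm M}^2+\frac{d^2}{4}&d>2{\rm M}\end{cases},\quad f^+_{\rm M}(d)=\begin{cases}{\rm M}^2+\frac{d^2}{4}&0<d\le2{\rm M}\\ {\rm M}d&d>2{\rm M}.\end{cases}$$ Domain: $${\mathbb P}=\{(d,f)\in{\mathbb R}^2:\ d>0,\ f^-_{{\rm M}_-}(d)<f<f^+_{{\rm M}_+}(d),\ f\ne f^{\rm s}_{{\rm M}_-}(d),\ f\ne f^{\rm s}_{{\rm M}_+}(d)\}.$$ ''Monotone'' is meant in the weak sense (constant functions are allowed: e.g. $\omega\equiv1$ when ${\rm M}_-={\rm M}_+$); the direction of monotonicity may depend on the connected component. *)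

(* Defs.v *)
From HB Require Import structures.
From mathcomp Require Import all_boot all_order all_algebra.
From mathcomp Require Import all_classical all_reals all_analysis.
Set Implicit Arguments.
Unset Strict Implicit.
Unset Printing Implicit Defensive.
Import Order.TTheory GRing.Theory Num.Theory.
Import numFieldNormedType.Exports.
Local Open Scope classical_set_scope.
Local Open Scope ring_scope.

Section EulerProblem.
Context {R : realType}.
Implicit Types (M Mm Mp d f : R).

Definition W_plus (v0 : R) Mp (J0 F0 alpha : R) : R :=
  (alpha ^+ 2 - 1) *
  (2 * J0 * v0 ^+ 2 * alpha ^+ 2 + 2 * Mp * v0 * alpha
   - (2 * J0 * v0 ^+ 2 + F0)).

Definition W_minus (v0 : R) Mm (J0 F0 beta : R) : R :=
  (1 - beta ^+ 2) *
  (- 2 * J0 * v0 ^+ 2 * beta ^+ 2 - 2 * Mm * v0 * beta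
   + (2 * J0 * v0 ^+ 2 + F0)).

(* Inverse of d = -4 v0 J0, f = -2 J0 F0, for d > 0. *)
Definition J0_of (v0 : R) d : R := - d / (4 * v0).
Definition F0_of (v0 : R) d f : R := 2 * v0 * f / d.

Definition is_component (A C : set R) : Prop :=
  exists2 x, A x & C = connected_component A x.

Definition nondegenerate_component (A : set R) (I : R * R) : Prop :=
  I.1 < I.2 /\ is_component A `[I.1, I.2].

(* The interval is picked by choice among the nondegenerate components. On the
   domain PP below at least one exists. The integrand takes the value 0, by
   0^-1 = 0, at the zeros of W, which form a null set. *)
Definition period (A : set R) (W : R -> R) : R :=
  let I := xget (0, 0) [set I | nondegenerate_component A I] in
  2 * \int[lebesgue_measure]_(x in `[I.1, I.2]) (Num.sqrt (W x))^-1.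

Definition tau_plus (v0 : R) Mp d f : R :=
  let W := W_plus v0 Mp (J0_of v0 d) (F0_of v0 d f) in
  period [set alpha | 1 <= alpha /\ 0 <= W alpha] W.

Definition tau_minus (v0 : R) Mm d f : R :=
  let W := W_minus v0 Mm (J0_of v0 d) (F0_of v0 d f) in
  period [set beta | -1 <= beta <= 1 /\ 0 <= W beta] W.

Definition omega (v0 : R) Mm Mp d f : R :=
  tau_minus v0 Mm d f / tau_plus v0 Mp d f.

Definition f_minus M d : R := - M * d.
Definition f_s M d : R :=
  if d <= 2 * M then M * d else M ^+ 2 + d ^+ 2 / 4.
Definition f_plus M d : R :=
  if d <= 2 * M then M ^+ 2 + d ^+ 2 / 4 else M * d.

Definition PP Mm Mp : set (R * R) :=
  [set df | [/\ 0 < df.1, f_minus Mm df.1 < df.2 < f_plus Mp df.1,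
                df.2 <> f_s Mm df.1 & df.2 <> f_s Mp df.1]].

Definition PP_slice Mm Mp d : set R := [set f | PP Mm Mp (d, f)].

Definition weakly_monotone_on (C : set R) (g : R -> R) : Prop :=
  {in C &, {homo g : x y / x <= y}} \/ {in C &, {homo g : x y /~ x <= y}}.

(* Components of PP_slice are open, so the two-sided derivative at each point
   of C only involves values of g on C. *)
Definition derivable_on (C : set R) (g : R -> R) : Prop :=
  forall x, C x -> derivable g x 1.

End EulerProblem.

(* Main.v *)
Require Import Defs.
From HB Require Import structures.
From mathcomp Require Import all_boot all_order all_algebra.
From mathcomp Require Import all_classical all_reals all_analysis.
From mathcomp Require Import measurable_realfun ring lra.
Import Order.TTheory GRing.Theory Num.Theory.
Import numFieldNormedType.Exports.
Local Open Scope classical_set_scope.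
Local Open Scope ring_scope.

(** Completing the square shows that W_plus and W_minus are one and the same
    quartic
      v0 / (2 d) * (x^2 - 1) * (s^2 - (d x - 2 M)^2),
      s^2 = 4 M^2 + d^2 - 4 f,
    with M = M_+ or M = M_-.  Its roots are -1, 1 and (2 M - s) / d,
    (2 M + s) / d, and each period is a complete elliptic integral between two
    adjacent roots.  All of them are brought to the normal form
      A(a, b) = int_0^oo dt / sqrt ((t^2 + a) (t^2 + b)),
    which is pi / 2 divided by the arithmetic-geometric mean of sqrt a and
    sqrt b.  It is written here with t = z / (1 - z), as the integral of a
    continuous function over [0, 1] ([agm_integral]).  A Moebius substitution
    removes the two endpoint singularities ([segment_integral_quartic]).  Above
    f_s(M), where the last two roots may be complex, Landen's quadratic
    transformation ([landen]) then splits the quartic into real factors.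

    The outcome is that only the side of f_s(M) on which f lies matters.
    Put c = v0 / (2 d).
      f < f_s(M):  tau = 4 A(4 c s d, c (2 s d + 2 d^2 - 4 f));
      f > f_s(M):  tau = 4 A(c (2 f - d^2 + 2 g), 4 c g),
                   g^2 = f^2 - M^2 d^2.
    The same two functions of (M, f) serve for tau_- (with M_-) and for tau_+
    (with M_+).  A connected component of the slice avoids f_s(M_-) and
    f_s(M_+), so on it each period is given by one of the two formulas.

    Monotonicity of the periods is then immediate: A decreases in both
    arguments, and both arguments decrease with f below f_s(M) and increase
    above it.  Differentiability holds because A is differentiable
    ([agm_integral_derivable]).

    For the rotation number, if M_- and M_+ are on different sides, the
    numerator and the denominator are monotone in opposite directions.  If
    they are on the same side, the quotient is T(M_-, f) / T(M_+, f) with a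
    single function T, and it increases with f if
      T(M_-, f1) T(M_+, f2) <= T(M_-, f2) T(M_+, f1)   for f1 <= f2.
    To see this, reverse the order of one of the variables M, f so that the
    arguments a, b of A increase in both; since the square root is concave,
    they are also submodular ([sqrt_submodular]).  This makes the integrand
    log-supermodular in the two variables together with z, and integrating
    over z preserves this property.  For two-by-two arrays that is Chebyshev's
    integral inequality ([chebyshev_unit_segment],
    [agm_integral_supermodular]). *)

Set Implicit Arguments.
Unset Strict Implicit.
Unset Printing Implicit Defensive.

(** * Change of variables *)

Section RealAnalysis.
Context {R : realType}.
Notation mu := (@lebesgue_measure R).
Implicit Types (a b x z : R) (F G f g : R -> R).

Lemma is_derive_continuous x f df : is_derive x 1 f df -> {for x, continuous f}.
Proof.
by case=> dfx _; apply/differentiable_continuous/derivable1_diffP.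
Qed.

Lemma segment_continuous a b f :
  (forall x, a <= x <= b -> {for x, continuous f}) ->
  {within `[a, b], continuous f}.
Proof.
move=> cf; apply: continuous_in_subspaceT => x; rewrite inE/= in_itv/=.
exact: cf.
Qed.

Lemma segment_integrable a b f :
  (forall x, a <= x <= b -> {for x, continuous f}) ->
  mu.-integrable `[a, b] (EFin \o f).
Proof.
move=> cf; apply: continuous_compact_integrable; first exact: segment_compact.
exact: segment_continuous.
Qed.

(** A two-sided derivative F' that is continuous on the closed segment yields
    all the regularity that the change of variables asks of [derive1 F]. *)
Lemma derive1_regular F (F' : R -> R) a b : a < b ->
  (forall x, a <= x <= b -> is_derive x 1 F (F' x)) ->
  (forall x, a <= x <= b -> {for x, continuous F'}) ->
  [/\ {in `]a, b[, continuous (derive1 F)},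
      cvg (derive1 F x @[x --> a^'+]), cvg (derive1 F x @[x --> b^'-]),
      derivable_oo_LRcontinuous F a b &
      forall x, a <= x <= b -> derive1 F x = F' x].
Proof.
move=> ab dF cF'.
have FE x : a <= x <= b -> derive1 F x = F' x.
  by move=> xab; rewrite derive1E; have [] := dF _ xab.
have FEoo x : x \in `]a, b[ -> derive1 F x = F' x.
  by rewrite in_itv/= => /andP[? ?]; apply: FE; rewrite !ltW.
have cF x : a <= x <= b -> {for x, continuous F}.
  by move=> /dF; exact: is_derive_continuous.
have aab : a <= a <= b by rewrite lexx ltW.
have bab : a <= b <= b by rewrite lexx ltW.
split => //.
- move=> x xab.
  have cx : {for x, continuous F'}.
    by apply: cF'; move: xab; rewrite in_itv/= => /andP[? ?]; rewrite !ltW.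
  rewrite /continuous_at FEoo//; apply: cvg_trans cx.
  apply: near_eq_cvg; near=> y; rewrite FEoo//.
  by near: y; exact: near_in_itvoo.
- apply/cvg_ex; exists (F' a).
  have := cvg_at_right_filter (cF' _ aab).
  apply: cvg_trans; apply: near_eq_cvg; near=> y; rewrite FEoo//.
  by rewrite in_itv/=; apply/andP; split; near: y;
    [exact: nbhs_right_gt|exact: nbhs_right_lt].
- apply/cvg_ex; exists (F' b).
  have := cvg_at_left_filter (cF' _ bab).
  apply: cvg_trans; apply: near_eq_cvg; near=> y; rewrite FEoo//.
  by rewrite in_itv/=; apply/andP; split; near: y;
    [exact: nbhs_left_gt|exact: nbhs_left_lt].
- split.
  + move=> x; rewrite in_itv/= => /andP[ax xb].
    by have [] : is_derive x 1 F (F' x) by apply: dF; rewrite !ltW.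
  + exact/cvg_at_right_filter/cF.
  + exact/cvg_at_left_filter/cF.
Unshelve. all: by end_near. Qed.

Lemma derive_gt0_increasing F (F' : R -> R) a b : a < b ->
  (forall x, a <= x <= b -> is_derive x 1 F (F' x)) ->
  (forall x, a < x < b -> 0 < F' x) ->
  {in `[a, b] &, {homo F : x y / x < y}}.
Proof.
move=> ab dF F'0; apply: gtr0_derive1_lt_cc.
- move=> x; rewrite in_itv/= => /andP[ax xb].
  by have [] : is_derive x 1 F (F' x) by apply: dF; rewrite !ltW.
- move=> x; rewrite in_itv/= => /andP[ax xb].
  have [_] : is_derive x 1 F (F' x) by apply: dF; rewrite !ltW.
  by rewrite derive1E => ->; apply: F'0; rewrite ax.
- by apply: segment_continuous => x /dF; exact: is_derive_continuous.
Qed.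

Lemma substitution_increasing F (F' : R -> R) G a b : a < b ->
  (forall x, a <= x <= b -> is_derive x 1 F (F' x)) ->
  (forall x, a <= x <= b -> {for x, continuous F'}) ->
  (forall x, a < x < b -> 0 < F' x) ->
  {within `[F a, F b], continuous G} ->
  (\int[mu]_(x in `[F a, F b]) (G x)%:E =
   \int[mu]_(x in `[a, b]) (G (F x) * F' x)%:E)%E.
Proof.
move=> ab dF cF' F'0 cG; have [? ? ? ? FE] := derive1_regular ab dF cF'.
rewrite (integration_by_substitution_increasing (ltW ab) _ _ _ _ _ cG)//.
- by apply: eq_integral => x; rewrite inE/= in_itv/= => xab; rewrite /= -FE.
- exact: derive_gt0_increasing dF F'0.
Qed.

Lemma substitution_decreasing F (F' : R -> R) G a b : a < b ->
  (forall x, a <= x <= b -> is_derive x 1 F (F' x)) ->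
  (forall x, a <= x <= b -> {for x, continuous F'}) ->
  (forall x, a < x < b -> F' x < 0) ->
  {within `[F b, F a], continuous G} ->
  (\int[mu]_(x in `[F b, F a]) (G x)%:E =
   \int[mu]_(x in `[a, b]) (G (F x) * - F' x)%:E)%E.
Proof.
move=> ab dF cF' F'0 cG; have [? ? ? ? FE] := derive1_regular ab dF cF'.
rewrite (integration_by_substitution_decreasing (ltW ab) _ _ _ _ _ cG)//.
- by apply: eq_integral => x; rewrite inE/= in_itv/= => xab; rewrite /= -FE.
- move=> x y xab yab xy; rewrite -ltrN2.
  have dN z : a <= z <= b -> is_derive z 1 (fun t => - F t) (- F' z).
    by move=> /dF; apply: is_deriveN.
  apply: (derive_gt0_increasing ab dN) => // z /F'0.
  by rewrite oppr_gt0.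
Qed.

(** The segments [e, 1 - e] with e = 1 / (n + 3) are nondegenerate and exhaust
    ]0, 1[; so do their images, by the intermediate value theorem. *)
Lemma bigcup_image_segments F : {in `[0, 1] &, {homo F : x y / x < y}} ->
  {within `[0, 1], continuous F} ->
  \bigcup_n `[F n.+3%:R^-1, F (1 - n.+3%:R^-1)]%classic = `]F 0, F 1[%classic.
Proof.
move=> hF cF; apply/seteqP; split => y /=.
  have n0 n : 0 < n.+3%:R^-1 :> R by rewrite invr_gt0.
  have n1 n : n.+3%:R^-1 < 1 :> R by rewrite invf_lt1// ltr1n.
  move=> [n _] /=; move: (n.+3%:R^-1) (n0 n) (n1 n) => e e0 e1.
  rewrite !in_itv/= => /andP[y1 y2].
  apply/andP; split.
    by apply: lt_le_trans y1; apply: hF; rewrite ?in_itv/= ?lexx ?ler01// !ltW.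
  apply: (le_lt_trans y2); apply: hF; rewrite ?in_itv/=; lra.
rewrite in_itv/= => /andP[y1 y2].
have y12 : Num.min (F 0) (F 1) <= y <= Num.max (F 0) (F 1).
  by rewrite ge_min le_max (ltW y1) (ltW y2) orbT.
have [x + Fx] := IVT ler01 cF y12.
rewrite in_itv/= => /andP[x0 x1].
have {}x0 : 0 < x.
  by rewrite lt_neqAle x0 andbT; apply/eqP => x0'; rewrite x0' Fx ltxx in y1.
have {}x1 : x < 1.
  by rewrite lt_neqAle x1 andbT; apply/eqP => x1'; rewrite -x1' Fx ltxx in y2.
have m0 : 0 < Num.min x (1 - x) by rewrite lt_min x0 subr_gt0.
have [n _ /(_ n (leqnn n)) /= Hn] := near_infty_natSinv_lt (PosNum m0).
have n3 : n.+3%:R^-1 < Num.min x (1 - x).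
  by apply: le_lt_trans Hn; rewrite lef_pV2 ?posrE ?ltr0n// ler_nat leqW// ltnS.
have n0 : 0 < n.+3%:R^-1 :> R by rewrite invr_gt0.
move: n3; rewrite lt_min => /andP[nx n1x].
exists n => //=; rewrite in_itv/= -Fx.
move: (n.+3%:R^-1) n0 nx n1x => e e0 ex e1x.
by apply/andP; split; apply: ltW; apply: hF; rewrite ?in_itv/=; lra.
Qed.

(** Here G may blow up at both ends of the interval, as the inverse square
    root of W does: the formula is obtained on compact segments and passes to
    the limit by monotone convergence. *)
Lemma substitution_oo F (F' : R -> R) G :
  (forall x, 0 <= x <= 1 -> is_derive x 1 F (F' x)) ->
  (forall x, 0 <= x <= 1 -> {for x, continuous F'}) ->
  (forall x, 0 < x < 1 -> 0 < F' x) ->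
  (forall x, F 0 < x < F 1 -> {for x, continuous G}) ->
  (forall x, F 0 < x < F 1 -> 0 <= G x) ->
  (\int[mu]_(x in `]F 0%R, F 1%R[) (G x)%:E =
   \int[mu]_(x in `]0%R, 1%R[) (G (F x) * F' x)%:E)%E.
Proof.
move=> dF cF' F'0 cG G0.
have hF := derive_gt0_increasing ltr01 dF F'0.
have cF : {within `[0, 1], continuous F}.
  by apply: segment_continuous => x /dF; exact: is_derive_continuous.
have FE := bigcup_image_segments hF cF.
have id_homo : {in `[0, 1] &, {homo @id R : x y / x < y}} by [].
have idE :=
  bigcup_image_segments id_homo (continuous_subspaceT (fun x => cvg_id)).
pose e (n : nat) : R := n.+3%:R^-1.
have e0 n : 0 < e n by rewrite invr_gt0.
have e2 n : e n < 1 - e n.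
  have : e n <= 3^-1 by rewrite lef_pV2 ?posrE// ler_nat.
  lra.
have le_e m n : (m <= n)%N -> e n <= e m.
  by move=> mn; rewrite lef_pV2 ?posrE ?ltr0n// ler_nat !ltnS.
have leF x y : 0 <= x <= 1 -> 0 <= y <= 1 -> x <= y -> F x <= F y.
  move=> x01 y01; rewrite le_eqVlt => /predU1P[->//|xy]; apply/ltW/hF => //.
have ltF x : 0 < x < 1 -> F 0 < F x < F 1.
  move=> x01; apply/andP; split; apply: hF; rewrite ?in_itv/=; lra.
have HL : (\int[mu]_(x in `[F (e n), F (1 - e n)%R]) (G x)%:E @[n --> \oo] -->
    \int[mu]_(x in `]F 0%R, F 1%R[) (G x)%:E)%E.
  rewrite -FE; apply: ge0_nondecreasing_set_cvg_integral.
  - move=> m n mn; apply/subsetPset; apply: subset_itv; rewrite bnd_simp;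
      apply: leF; have := le_e _ _ mn; have := e0 n; have := e2 n;
        have := e2 m; lra.
  - by move=> n; exact: measurable_itv.
  - move=> n; apply/measurable_EFinP;
    apply: subspace_continuous_measurable_fun => //.
    apply: segment_continuous => x xF; apply: cG.
    have := ltF (e n) ltac:(have := e0 n; have := e2 n; lra).
    have := ltF (1 - e n) ltac:(have := e0 n; have := e2 n; lra).
    move: xF; lra.
  - move=> n x; rewrite /= in_itv/= => xF; rewrite lee_fin; apply: G0.
    have := ltF (e n) ltac:(have := e0 n; have := e2 n; lra).
    have := ltF (1 - e n) ltac:(have := e0 n; have := e2 n; lra).
    move: xF; lra.
have in01 n x : e n <= x <= 1 - e n -> 0 < x < 1 by have := e0 n; lra.
have HR : (\int[mu]_(x in `[e n, (1 - e n)%R]) (G (F x) * F' x)%:E @[n --> \oo]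
  -->
    \int[mu]_(x in `]0%R, 1%R[) (G (F x) * F' x)%:E)%E.
  rewrite -idE; apply: ge0_nondecreasing_set_cvg_integral.
  - move=> m n mn; apply/subsetPset; apply: subset_itv; rewrite bnd_simp;
      have := le_e _ _ mn; lra.
  - by move=> n; exact: measurable_itv.
  - move=> n; apply/measurable_EFinP;
    apply: subspace_continuous_measurable_fun => //.
    apply: segment_continuous => x /in01 x01.
    have x01' : 0 <= x <= 1 by move: x01; lra.
    apply: cvgM; last exact: cF'.
    apply: continuous_comp; last by apply: cG; exact: ltF.
    exact: is_derive_continuous (dF _ x01').
  - move=> n x; rewrite /= in_itv/= => /in01 x01; rewrite lee_fin mulr_ge0//.
      by apply: G0; exact: ltF.
    by apply: ltW; exact: F'0.
apply: (cvg_unique (@ereal_hausdorff R) HL _).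
apply: cvg_trans HR; apply: near_eq_cvg; apply: nearW => n /=; apply/esym.
apply: substitution_increasing => //.
- move=> x /in01; move=> x01; apply: dF; lra.
- move=> x /in01; move=> x01; apply: cF'; lra.
- by move=> x xe; apply: F'0; apply: (in01 n); lra.
- apply: segment_continuous => x xF; apply: cG.
  have := ltF (e n) ltac:(have := e0 n; have := e2 n; lra).
  have := ltF (1 - e n) ltac:(have := e0 n; have := e2 n; lra).
  move: xF; lra.
Qed.

End RealAnalysis.

(** * Removal of the endpoint singularities *)

Section QuarticIntegral.
Context {R : realType}.
Notation mu := (@lebesgue_measure R).
Implicit Types (a b c z x P Q : R) (f : R -> R).

(** In the variable t = z / (1 - z) this is (1 - z)^4 (t^4 + P t^2 + Q), and
    dt = dz / (1 - z)^2, so that [quartic_integral] is the integral of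
    1 / sqrt (t^4 + P t^2 + Q) over the positive half line. *)
Definition quartic P Q z : R :=
  z ^+ 4 + P * (z ^+ 2 * (1 - z) ^+ 2) + Q * (1 - z) ^+ 4.

Definition quartic_integral P Q : R :=
  \int[mu]_(z in `[0, 1]) (Num.sqrt (quartic P Q z))^-1.

Lemma weighted_squares_gt0 c z : 0 < c -> 0 < c * (1 - z) ^+ 2 + z ^+ 2.
Proof.
move=> c0; have [->|z0] := eqVneq z 0.
  by rewrite subr0 expr1n expr0n/=; lra.
apply: ltr_wpDl; first by rewrite mulr_ge0 ?sqr_ge0// ltW.
by rewrite exprn_even_gt0.
Qed.

Lemma quartic_gt0 P b z : 0 < b -> 0 < P + 2 * b -> 0 < quartic P (b ^+ 2) z.
Proof.
move=> b0 Pb.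
have -> : quartic P (b ^+ 2) z =
    (z ^+ 2 - b * (1 - z) ^+ 2) ^+ 2 + (P + 2 * b) * (z * (1 - z)) ^+ 2.
  by rewrite /quartic; ring.
have [zz|zz] := eqVneq (z * (1 - z)) 0; last first.
  by apply: ltr_wpDl; rewrite ?sqr_ge0// mulr_gt0// exprn_even_gt0.
rewrite zz expr0n/= mulr0 addr0 exprn_even_gt0//=.
move: zz => /eqP; rewrite mulf_eq0 => /orP[|] /eqP zz.
  by rewrite zz subr0 expr1n expr0n/= mulr1 sub0r oppr_eq0 gt_eqF.
have -> : z = 1 by lra.
by rewrite subrr expr0n/= mulr0 subr0 expr1n oner_neq0.
Qed.

Lemma invsqrt_continuous f x :
  {for x, continuous f} -> 0 < f x ->
  {for x, continuous (fun y : R => (Num.sqrt (f y))^-1 : R)}.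
Proof.
move=> cf f0; apply: cvgV; first by rewrite gt_eqF// sqrtr_gt0.
by apply: continuous_comp => //; exact: sqrt_continuous.
Qed.

Lemma quartic_continuous P Q z : {for z, continuous (quartic P Q)}.
Proof. by apply: is_derive_continuous; exact: derivableP. Qed.

(** The inverse square roots met below take the conventional value 0 at the
    endpoints, which form a null set. *)
Lemma integral_open_segment f a b :
  (forall x, a < x < b -> {for x, continuous f}) ->
  (\int[mu]_(x in `[a, b]) (f x)%:E = \int[mu]_(x in `]a, b[) (f x)%:E)%E.
Proof.
move=> cf.
have mf : measurable_fun `]a, b[ (EFin \o f).
  apply/measurable_EFinP; apply: open_continuous_measurable_fun.
    exact: interval_open.
  by move=> x; rewrite inE/= in_itv/=; exact: cf.
rewrite -integral_itv_obnd_cbnd; last exact/emeasurable_fun_itv_bndo_bndcP.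
by rewrite -integral_itv_bndo_bndc.
Qed.

(** The substitution x = (al t_0^2 + be t^2) / (t_0^2 + t^2), with
    t_0^2 = q be, sends the roots al, be to t = 0, oo.  It turns
    (x - al) (be - x) q x into a multiple of t^2 times a biquadratic
    polynomial, and the choice of t_0 makes the leading coefficient 1.  The
    middle coefficient is twice the polar form of q at (al, be). *)
Lemma segment_integral_quartic al be q0 q1 q2 (W q : R -> R) :
  q = (fun x => q2 * x ^+ 2 + q1 * x + q0) ->
  al < be ->
  (forall x, al <= x <= be -> 0 < q x) ->
  (forall x, al <= x <= be -> W x = (x - al) * (be - x) * q x) ->
  \int[mu]_(x in `[al, be]) (Num.sqrt (W x))^-1 =
  2 * quartic_integral (2 * q2 * al * be + q1 * (al + be) + 2 * q0)
                       (q al * q be).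
Proof.
move=> qE albe q_gt0 WE.
set C := 2 * q2 * al * be + _ + _; set Q := q al * q be.
pose k := q be; pose D z := k * (1 - z) ^+ 2 + z ^+ 2.
pose F z := (al * (k * (1 - z) ^+ 2) + be * z ^+ 2) / D z.
pose F' z := 2 * (be - al) * k * (z * (1 - z)) / D z ^+ 2.
have k0 : 0 < k by apply: q_gt0; rewrite lexx ltW.
have D0 z : 0 < D z by exact: weighted_squares_gt0.
have D_neq0 z : D z != 0 by rewrite gt_eqF.
have dF z : is_derive z 1 F (F' z).
  have := D_neq0 z; rewrite /F /F' /D => Dz.
  apply: is_derive_eq.
  rewrite /GRing.scale /=; field; exact: Dz.
have qF z : q (F z) = k * quartic C Q z / D z ^+ 2.
  rewrite /C /Q /F /quartic; have := D_neq0 z; rewrite /D /k qE => Dz.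
  by field.
have Fal z : F z - al = (be - al) * z ^+ 2 / D z.
  by have := D_neq0 z; rewrite /F /D => Dz; field.
have beF z : be - F z = (be - al) * (k * (1 - z) ^+ 2) / D z.
  by have := D_neq0 z; rewrite /F /D => Dz; field.
have F01 z : al <= F z <= be.
  have al_be : 0 <= be - al by rewrite subr_ge0 ltW.
  apply/andP; split; rewrite -subr_ge0 ?Fal ?beF.
    by rewrite divr_ge0 ?(ltW (D0 _))// mulr_ge0// sqr_ge0.
  rewrite divr_ge0 ?(ltW (D0 _))// mulr_ge0// mulr_ge0 ?sqr_ge0//.
  exact: ltW.
have E0 z : 0 < quartic C Q z.
  move: (F01 z) => /q_gt0; rewrite qF pmulr_lgt0 ?invr_gt0 ?exprn_gt0//.
  by rewrite pmulr_rgt0.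
pose V x := (x - al) * (be - x) * q x.
have VF z : V (F z) =
    ((be - al) * k * (z * (1 - z)) / D z ^+ 2) ^+ 2 * quartic C Q z.
  by rewrite /V Fal beF qF; have := D_neq0 z => Dz; field.
have F'_gt0 z : 0 < z < 1 -> 0 < F' z.
  move=> /andP[z0 z1]; rewrite /F' divr_gt0 ?exprn_gt0//.
  by rewrite !mulr_gt0// subr_gt0.
have Fl : F 0 = al.
  by rewrite /F /D subr0 expr1n expr0n/= !mulr1 mulr0 !addr0 mulfK ?gt_eqF.
have Fr : F 1 = be.
  by rewrite /F /D subrr expr1n expr0n/= !mulr0 !add0r mulr1 divr1.
have dq x : {for x, continuous q}.
  by rewrite qE; apply: is_derive_continuous; exact: derivableP.
have cV x : al < x < be ->
  {for x, continuous (fun y => (Num.sqrt (V y))^-1 : R)}.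
  move=> /andP[xal xbe]; apply: invsqrt_continuous.
    apply: continuousM; last exact: dq.
    by apply: is_derive_continuous; exact: derivableP.
  by rewrite !mulr_gt0 ?subr_gt0// q_gt0// !ltW.
have cF' z : {for z, continuous F'}.
  have : D z ^+ 2 != 0 by rewrite expf_neq0.
  by rewrite /F' /D => Dz; apply: is_derive_continuous; exact: is_derive_eq.
have cE z : {for z, continuous (fun y => (Num.sqrt (quartic C Q y))^-1 : R)}.
  by apply: invsqrt_continuous => //; exact: quartic_continuous.
rewrite /Rintegral; transitivity
   (fine (\int[mu]_(x in `[al, be]) ((Num.sqrt (V x))^-1)%:E)%E).
  congr fine; apply: eq_integral => x; rewrite inE/= in_itv/= => xab.
  by rewrite WE.
rewrite integral_open_segment//.
have := @substitution_oo _ F F' (fun x => (Num.sqrt (V x))^-1);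
  rewrite Fl Fr => ->//.
rewrite -[RHS]RintegralZl//; last exact: segment_integrable.
rewrite /Rintegral integral_open_segment; last first.
  by move=> z _; apply: cvgM; [exact: cvg_cst|exact: cE].
congr fine; apply: eq_integral => z; rewrite inE/= in_itv/= => /andP[z0 z1].
congr EFin; rewrite VF sqrtrM ?sqr_ge0// sqrtr_sqr ger0_norm; last first.
  by rewrite divr_ge0 ?mulr_ge0 ?subr_ge0 ?exprn_ge0 ?ltW.
rewrite /F'; have := D_neq0 z; have z_neq0 : z != 0 by rewrite gt_eqF.
have z_neq1 : 1 - z != 0 by rewrite subr_eq0 gt_eqF.
have ba : be - al != 0 by rewrite subr_eq0 gt_eqF.
have kn0 : k != 0 by rewrite gt_eqF.
have : Num.sqrt (quartic C Q z) != 0 by rewrite gt_eqF// sqrtr_gt0.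
by move=> sE Dz; field; rewrite sE Dz z_neq1 z_neq0 kn0.
Qed.

End QuarticIntegral.

(** * Landen's transformation *)

Section Landen.
Context {R : realType}.
Notation mu := (@lebesgue_measure R).
Implicit Types (a b c z x P Q : R).

(** With t = z / (1 - z), the map w = e N / (e N + 2 z (1 - z)),
    N = z^2 - b (1 - z)^2, is Gauss's substitution u = e (t - b / t) / 2
    written in the variable w = u / (1 + u).  The sign e = 1 is used for
    t^2 >= b and e = -1 for t^2 <= b. *)
Lemma landen_derive b (e : R) z :
  e * (z ^+ 2 - b * (1 - z) ^+ 2) + 2 * z * (1 - z) != 0 ->
  is_derive z 1
    (fun t => e * (t ^+ 2 - b * (1 - t) ^+ 2) /
              (e * (t ^+ 2 - b * (1 - t) ^+ 2) + 2 * t * (1 - t)))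
    (e * (2 * (z ^+ 2 + b * (1 - z) ^+ 2)) /
      (e * (z ^+ 2 - b * (1 - z) ^+ 2) + 2 * z * (1 - z)) ^+ 2).
Proof.
move=> D0; apply: is_derive_eq; rewrite /GRing.scale /=.
by field.
Qed.

(** Gauss's identities u^2 + b = (t + b / t)^2 / 4 and
    u^2 + (P + 2 b) / 4 = (t^4 + P t^2 + b^2) / (4 t^2). *)
Lemma landen_quartic b P (e : R) z : e ^+ 2 = 1 ->
  e * (z ^+ 2 - b * (1 - z) ^+ 2) + 2 * z * (1 - z) != 0 ->
  let a := (P + 2 * b) / 4 in
  let D := e * (z ^+ 2 - b * (1 - z) ^+ 2) + 2 * z * (1 - z) in
  quartic (a + b) (a * b) (e * (z ^+ 2 - b * (1 - z) ^+ 2) / D) =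
    ((z ^+ 2 + b * (1 - z) ^+ 2) / D ^+ 2) ^+ 2 * quartic P (b ^+ 2) z.
Proof.
move=> e2 D0 a D.
have e3 : e * e * e = e by rewrite -expr2 e2 mul1r.
have ND : 1 - e * (z ^+ 2 - b * (1 - z) ^+ 2) / D = 2 * z * (1 - z) / D.
  by rewrite /D; field.
have -> : quartic (a + b) (a * b) (e * (z ^+ 2 - b * (1 - z) ^+ 2) / D) =
  ((e ^+ 2 * (z ^+ 2 - b * (1 - z) ^+ 2) ^+ 2 + a * (2 * z * (1 - z)) ^+ 2) *
  (e ^+ 2 * (z ^+ 2 - b * (1 - z) ^+ 2) ^+ 2 + b * (2 * z * (1 - z)) ^+ 2))
   / D ^+ 4.
  by rewrite /quartic ND /D; field.
by rewrite e2 /quartic /a; field; rewrite D0.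
Qed.

Lemma landen_half b P (e : R) z : e ^+ 2 = 1 -> 0 < b -> 0 < P + 2 * b ->
  0 < e * (z ^+ 2 - b * (1 - z) ^+ 2) + 2 * z * (1 - z) ->
  let a := (P + 2 * b) / 4 in
  let D := e * (z ^+ 2 - b * (1 - z) ^+ 2) + 2 * z * (1 - z) in
  (Num.sqrt (quartic (a + b) (a * b) (e * (z ^+ 2 - b * (1 - z) ^+ 2) / D)))^-1
    * (2 * (z ^+ 2 + b * (1 - z) ^+ 2) / D ^+ 2) =
  2 * (Num.sqrt (quartic P (b ^+ 2) z))^-1.
Proof.
move=> e2 b0 Pb D0 a D.
have Dn0 : D != 0 by rewrite gt_eqF.
rewrite landen_quartic// -/D.
have S0 : 0 < z ^+ 2 + b * (1 - z) ^+ 2.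
  by rewrite addrC; exact: weighted_squares_gt0.
rewrite sqrtrM ?sqr_ge0// sqrtr_sqr gtr0_norm; last first.
  by rewrite divr_gt0 ?exprn_gt0.
have : Num.sqrt (quartic P (b ^+ 2) z) != 0.
  by rewrite gt_eqF// sqrtr_gt0 quartic_gt0.
have Sn0 : z ^+ 2 + b * (1 - z) ^+ 2 != 0 by rewrite gt_eqF.
move: (Num.sqrt _) => s s0; field.
by rewrite s0 Dn0 Sn0.
Qed.

(** Each of the half lines t^2 <= b and t^2 >= b is mapped onto the positive
    half line, and contributes half of the right-hand side. *)
Lemma landen P b : 0 < b -> 0 < P + 2 * b ->
  quartic_integral P (b ^+ 2) =
  quartic_integral ((P + 2 * b) / 4 + b) ((P + 2 * b) / 4 * b).
Proof.
move=> b0 Pb.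
set a := (P + 2 * b) / 4.
(* z0 is the point t = sqrt b, where the two halves meet *)
pose r := Num.sqrt b; pose z0 := r / (1 + r).
have r0 : 0 < r by rewrite sqrtr_gt0.
have br : b = r ^+ 2 by rewrite sqr_sqrtr// ltW.
have z0E : z0 * (1 + r) = r by rewrite mulfVK// gt_eqF// addr_gt0.
have z00 : 0 < z0 by rewrite divr_gt0// addr_gt0.
have z01 : z0 < 1 by rewrite ltr_pdivrMr ?addr_gt0// mul1r; lra.
pose N z := z ^+ 2 - b * (1 - z) ^+ 2.
have NE z : N z = (z + r * (1 - z)) * ((z - z0) * (1 + r)).
  have -> : (z - z0) * (1 + r) = z - r * (1 - z) by rewrite mulrBl z0E; ring.
  by rewrite /N br; ring.
have a0 : 0 < a by rewrite /a divr_gt0.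
pose G z : R := (Num.sqrt (quartic (a + b) (a * b) z))^-1.
pose H z : R := (Num.sqrt (quartic P (b ^+ 2) z))^-1.
have cH z : {for z, continuous H}.
  by apply: invsqrt_continuous; [exact: quartic_continuous|exact: quartic_gt0].
have cG z : {for z, continuous G}.
  apply: invsqrt_continuous; first exact: quartic_continuous.
  have -> : quartic (a + b) (a * b) z =
      (a * (1 - z) ^+ 2 + z ^+ 2) * (b * (1 - z) ^+ 2 + z ^+ 2).
    by rewrite /quartic; ring.
  by rewrite mulr_gt0 ?weighted_squares_gt0.
have cGw u v : {within `[u, v], continuous G} by apply: segment_continuous.
pose D e z := e * N z + 2 * z * (1 - z).
pose F e z := e * N z / D e z.
pose F' e z := e * (2 * (z ^+ 2 + b * (1 - z) ^+ 2)) / D e z ^+ 2.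
have half e u v : e ^+ 2 = 1 -> u < v -> (forall z, u <= z <= v -> 0 < D e z) ->
  \int[mu]_(z in `[u, v]) (G (F e z) * (e * F' e z)) =
  2 * \int[mu]_(z in `[u, v]) H z.
  move=> e2 uv D0; rewrite -RintegralZl//; last exact: segment_integrable.
  apply: eq_Rintegral => z; rewrite inE/= in_itv/= => /D0 Dz.
  rewrite -(@landen_half _ _ e)// /G -/(N z) -/(D e z) -/(F e z) /F' -/(G _).
  by congr (_ * _); rewrite mulrA [e * (e * _)]mulrA -expr2 e2 mul1r.
have dF e z : 0 < D e z -> is_derive z 1 (F e) (F' e z).
  by move=> D0; apply: landen_derive => //; rewrite gt_eqF.
have cF' e z : 0 < D e z -> {for z, continuous (F' e)}.
  move=> D0; have : D e z ^+ 2 != 0 by rewrite expf_neq0// gt_eqF.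
  by rewrite /F' /D /N => Dz; apply: is_derive_continuous; exact: is_derive_eq.
have S0 z : 0 < 2 * (z ^+ 2 + b * (1 - z) ^+ 2).
  by rewrite mulr_gt0// addrC weighted_squares_gt0.
have hi : \int[mu]_(z in `[0, 1]) G z = 2 * \int[mu]_(z in `[z0, 1]) H z.
  have D0 z : z0 <= z <= 1 -> 0 < D 1 z.
    move=> /andP[zz0]; rewrite /D mul1r le_eqVlt => /predU1P[->|z1].
      by rewrite /N subrr expr0n expr1n/= !mulr0 subr0 addr0.
    have z_gt0 : 0 < z by exact: lt_le_trans zz0.
    have y_gt0 : 0 < 1 - z by rewrite subr_gt0.
    apply: ltr_wpDl; last by rewrite !mulr_gt0.
    by rewrite NE !mulr_ge0 ?subr_ge0// ?addr_ge0 ?mulr_ge0// ltW.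
  have Fz0 : F 1 z0 = 0 by rewrite /F NE subrr !(mul0r, mulr0).
  have F1 : F 1 1 = 1.
    by rewrite /F /D /N subrr expr0n expr1n/= !mulr0 subr0 addr0 !mul1r invr1.
  have F'_gt0 z : z0 < z < 1 -> 0 < F' 1 z.
    move=> /andP[zz0 z1]; rewrite /F' mul1r divr_gt0// exprn_gt0// D0//.
    by rewrite !ltW.
  have HS := @substitution_increasing _ (F 1) (F' 1) G z0 1 z01
    (fun z zz => dF 1 z (D0 z zz)) (fun z zz => cF' 1 z (D0 z zz))
    F'_gt0 (cGw _ _).
  rewrite -(half 1) ?expr1n// /Rintegral -{1}Fz0 -{2}F1 HS.
  by congr fine; apply: eq_integral => z _; rewrite mul1r.
have lo : \int[mu]_(z in `[0, 1]) G z = 2 * \int[mu]_(z in `[0, z0]) H z.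
  have D0 z : 0 <= z <= z0 -> 0 < D (-1) z.
    move=> /andP[+ zz0]; rewrite /D mulN1r le_eqVlt => /predU1P[<-|z_gt0].
      by rewrite /N !subr0 expr0n expr1n/= !mulr1 mulr0 addr0 sub0r opprK.
    have y_gt0 : 0 < 1 - z by rewrite subr_gt0 (le_lt_trans zz0).
    apply: ltr_wpDl; last by rewrite !mulr_gt0.
    rewrite NE -mulrN -mulNr opprB.
    by rewrite !mulr_ge0 ?subr_ge0// ?addr_ge0 ?mulr_ge0// ltW.
  have Fz0 : F (-1) z0 = 0 by rewrite /F NE subrr !(mul0r, mulr0).
  have F0 : F (-1) 0 = 1.
    rewrite /F /D /N !subr0 expr0n expr1n/= !mulr1 mulr0 addr0 sub0r mulN1r
      opprK.
    by rewrite divff// gt_eqF.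
  have F'_lt0 z : 0 < z < z0 -> F' (-1) z < 0.
    move=> /andP[z_gt0 zz0]; rewrite /F' mulN1r mulNr oppr_lt0 divr_gt0//.
    by rewrite exprn_gt0// D0// !ltW.
  have HS := @substitution_decreasing _ (F (-1)) (F' (-1)) G 0 z0 z00
    (fun z zz => dF (-1) z (D0 z zz)) (fun z zz => cF' (-1) z (D0 z zz))
    F'_lt0 (cGw _ _).
  rewrite -(half (-1)) ?sqrrN ?expr1n// /Rintegral -{1}Fz0 -{2}F0 HS.
  by congr fine; apply: eq_integral => z _; rewrite mulN1r.
have : \int[mu]_(z in `[0, 1]) H z =
    \int[mu]_(z in `[0, z0]) H z + \int[mu]_(z in `[z0, 1]) H z.
  have iH u v : mu.-integrable `[u, v] (EFin \o H) by exact: segment_integrable.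
  have iHo : mu.-integrable `]z0, 1] (EFin \o H).
    by apply: integrableS (iH z0 1) => //; exact: subset_itv_oc_cc.
  apply/eqP; rewrite addrC -subr_eq Rintegral_itvB ?bnd_simp ?ltW//.
  by rewrite Rintegral_itv_obnd_cbnd.
rewrite /quartic_integral => HH; rewrite [LHS]HH.
apply: (@mulfI _ 2); first by rewrite pnatr_eq0.
by rewrite mulrDr -lo -hi -mulr2n mulr_natl.
Qed.

End Landen.

(** * The normal form and Chebyshev inequality *)

Section AgmIntegral.
Context {R : realType}.
Notation mu := (@lebesgue_measure R).
Implicit Types (a b c z x P Q : R).

(** This is pi / 2 divided by the arithmetic-geometric mean of sqrt a and
    sqrt b: with t = z / (1 - z), the integrand is
    dt / sqrt ((t^2 + a) (t^2 + b)). *)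
Definition agm_integral a b : R := quartic_integral (a + b) (a * b).

Lemma quartic_factor a b z : quartic (a + b) (a * b) z =
  (a * (1 - z) ^+ 2 + z ^+ 2) * (b * (1 - z) ^+ 2 + z ^+ 2).
Proof. by rewrite /quartic; ring. Qed.

Lemma quartic_factor_gt0 a b z : 0 < a -> 0 < b ->
  0 < quartic (a + b) (a * b) z.
Proof.
by move=> a0 b0; rewrite quartic_factor mulr_gt0 ?weighted_squares_gt0.
Qed.

Lemma agm_kernel_continuous a b z : 0 < a -> 0 < b ->
  {for z, continuous (fun y => (Num.sqrt (quartic (a + b) (a * b) y))^-1 : R)}.
Proof.
move=> a0 b0; apply: invsqrt_continuous; first exact: quartic_continuous.
exact: quartic_factor_gt0.
Qed.

Lemma agm_kernel_integrable a b : 0 < a -> 0 < b -> mu.-integrable `[0, 1]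
  (EFin \o (fun y => (Num.sqrt (quartic (a + b) (a * b) y))^-1)).
Proof.
by move=> a0 b0; apply: segment_integrable => z _; exact: agm_kernel_continuous.
Qed.

Lemma unit_segment_integral_cst c : \int[mu]_(z in `[0, 1]) c = c.
Proof.
by rewrite Rintegral_cst//= lebesgue_measure_itv/= lte_fin ltr01 oppr0 adde0
  mulr1.
Qed.

Lemma agm_integral_gt0 a b : 0 < a -> 0 < b -> 0 < agm_integral a b.
Proof.
move=> a0 b0; rewrite /agm_integral /quartic_integral.
pose M := (a + 1) * (b + 1).
have M0 : 0 < M by rewrite mulr_gt0// addr_gt0.
apply: (@lt_le_trans _ _ (Num.sqrt M)^-1); first by rewrite invr_gt0 sqrtr_gt0.
rewrite -[leLHS]unit_segment_integral_cst; apply: le_Rintegral => //.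
- apply: segment_integrable => z _; exact: cvg_cst.
- exact: agm_kernel_integrable.
- move=> z; rewrite /= in_itv/= => /andP[z0 z1].
  rewrite lef_pV2 ?posrE ?sqrtr_gt0 ?quartic_factor_gt0// ler_wsqrtr//.
  have z2 : z ^+ 2 <= 1 by rewrite exprn_ile1.
  have y2 : (1 - z) ^+ 2 <= 1 by rewrite exprn_ile1//; lra.
  rewrite quartic_factor; apply: ler_pM;
    try by rewrite ltW ?weighted_squares_gt0.
    by rewrite lerD// ler_piMr// ltW.
  by rewrite lerD// ler_piMr// ltW.
Qed.

Lemma le_agm_integral a b a' b' : 0 < a -> 0 < b -> a <= a' -> b <= b' ->
  agm_integral a' b' <= agm_integral a b.
Proof.
move=> a0 b0 aa' bb'; have a'0 := lt_le_trans a0 aa'.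
have b'0 := lt_le_trans b0 bb'.
apply: le_Rintegral => //; try exact: agm_kernel_integrable.
move=> z _; rewrite lef_pV2 ?posrE ?sqrtr_gt0 ?quartic_factor_gt0//
  ler_wsqrtr//.
rewrite !quartic_factor; apply: ler_pM;
  rewrite ?(ltW (weighted_squares_gt0 _ _))//.
all: by rewrite lerD2r ler_wpM2r ?sqr_ge0.
Qed.

(** With respect to the weight k11, the increasing functions k12 / k11 and
    k21 / k11 are positively correlated.  Let c be a point where k12 / k11
    equals its mean value sg, and rh the value of k21 / k11 there.  The product
    (k21 / k11 - rh) (k12 / k11 - sg) is nonnegative, because both factors
    change sign at c; integrated against k11, it gives the inequality. *)
Lemma chebyshev_unit_segment (k11 k12 k21 k22 : R -> R) :
  (forall z, 0 <= z <= 1 -> {for z, continuous k11}) ->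
  (forall z, 0 <= z <= 1 -> {for z, continuous k12}) ->
  (forall z, 0 <= z <= 1 -> {for z, continuous k21}) ->
  (forall z, 0 <= z <= 1 -> {for z, continuous k22}) ->
  (forall z, 0 <= z <= 1 -> 0 < k11 z) ->
  (forall s t, 0 <= s <= t -> t <= 1 -> k12 s * k11 t <= k12 t * k11 s) ->
  (forall s t, 0 <= s <= t -> t <= 1 -> k21 s * k11 t <= k21 t * k11 s) ->
  (forall z, 0 <= z <= 1 -> k12 z * k21 z <= k11 z * k22 z) ->
  0 < \int[mu]_(z in `[0, 1]) k11 z ->
  (\int[mu]_(z in `[0, 1]) k12 z) * (\int[mu]_(z in `[0, 1]) k21 z) <=
  (\int[mu]_(z in `[0, 1]) k11 z) * (\int[mu]_(z in `[0, 1]) k22 z).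
Proof.
move=> c11 c12 c21 c22 k0 m12 m21 le_k I0.
have i11 := segment_integrable c11; have i12 := segment_integrable c12.
have i21 := segment_integrable c21; have i22 := segment_integrable c22.
set I11 := Rintegral _ _ _ in I0 *; set I12 := Rintegral _ _ _.
set I21 := Rintegral _ _ _; set I22 := Rintegral _ _ _.
pose sg := I12 / I11.
have lbI u : (forall z, 0 <= z <= 1 -> u * k11 z <= k12 z) -> u <= sg.
  move=> ule; rewrite ler_pdivlMr// -RintegralZl//.
  apply: le_Rintegral => //.
  by apply: segment_integrable => z /c11 cz; apply: continuousM => //;
    exact: cvg_cst.
have ubI u : (forall z, 0 <= z <= 1 -> k12 z <= u * k11 z) -> sg <= u.
  move=> ule; rewrite ler_pdivrMr// -RintegralZl//.
  apply: le_Rintegral => //.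
  by apply: segment_integrable => z /c11 cz; apply: continuousM => //;
    exact: cvg_cst.
have [c c01 Hc] : exists2 c, c \in `[0, 1] & k12 c / k11 c = sg.
  have u0 : 0 <= (0:R) <= 1 by rewrite lexx ler01.
  have u1 : 0 <= (1:R) <= 1 by rewrite lexx ler01.
  apply: IVT => //.
    apply: segment_continuous => z z01; apply: continuousM; first exact: c12.
    by apply: continuousV; [rewrite gt_eqF// k0|exact: c11].
  rewrite ge_min le_max; apply/andP; split; apply/orP; [left|right].
    apply: lbI => z /andP[z0 z1]; rewrite mulrAC ler_pdivrMr ?k0//.
    by apply: m12 => //; rewrite lexx.
  apply: ubI => z /andP[z0 z1]; rewrite mulrAC ler_pdivlMr ?k0//.
  by apply: m12 => //; rewrite z0.
have {}c01 : 0 <= c <= 1 by rewrite in_itv in c01.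
have kc := k0 _ c01.
have {}Hc : k12 c = sg * k11 c by rewrite -Hc divfK// gt_eqF.
pose rh := k21 c / k11 c.
have Hr : k21 c = rh * k11 c by rewrite divfK// gt_eqF.
have pointwise z : 0 <= z <= 1 ->
    sg * k21 z + rh * (k12 z - sg * k11 z) <= k22 z.
  move=> z01; have kz := k0 _ z01; have lez := le_k _ z01.
  have sgn : 0 <= (k21 z - rh * k11 z) * (k12 z - sg * k11 z).
    have [zc|cz] := leP z c.
      have H1 : k21 z <= rh * k11 z.
        have := m21 z c; rewrite Hr mulrAC ler_pM2r//; apply; move: z01 c01;
          lra.
      have H2 : k12 z <= sg * k11 z.
        have := m12 z c; rewrite Hc mulrAC ler_pM2r//; apply; move: z01 c01;
          lra.
      by rewrite -mulrNN mulr_ge0// oppr_ge0 subr_le0.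
    have H1 : rh * k11 z <= k21 z.
      have := m21 c z; rewrite Hr mulrAC ler_pM2r//; apply; move: z01 c01; lra.
    have H2 : sg * k11 z <= k12 z.
      have := m12 c z; rewrite Hc mulrAC ler_pM2r//; apply; move: z01 c01; lra.
    by rewrite mulr_ge0// subr_ge0.
  rewrite -(ler_pM2l kz); nra.
have c3 z : 0 <= z <= 1 ->
  {for z, continuous (fun t => rh * (k12 t - sg * k11 t))}.
  move=> z01; apply: continuousM; first exact: cvg_cst.
  apply: continuousB; first exact: c12.
  by apply: continuousM; [exact: cvg_cst|exact: c11].
have c4 z : 0 <= z <= 1 -> {for z, continuous (fun t => sg * k21 t)}.
  by move=> z01; apply: continuousM; [exact: cvg_cst|exact: c21].
have c5 z : 0 <= z <= 1 -> {for z, continuous (fun t => sg * k11 t)}.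
  by move=> z01; apply: continuousM; [exact: cvg_cst|exact: c11].
have c6 z : 0 <= z <= 1 -> {for z, continuous (fun t => k12 t - sg * k11 t)}.
  by move=> z01; apply: continuousB; [exact: c12|exact: c5].
have : \int[mu]_(z in `[0, 1]) (sg * k21 z + rh * (k12 z - sg * k11 z)) <= I22.
  apply: le_Rintegral => //.
  by apply: segment_integrable => z z01; apply: continuousD;
    [exact: c4|exact: c3].
rewrite RintegralD//; [|exact: segment_integrable..].
rewrite !RintegralZl//; [|exact: segment_integrable..].
rewrite RintegralB//; [|exact: segment_integrable..].
rewrite RintegralZl// -/I11 -/I12 -/I21 /sg divfK ?gt_eqF// subrr mulr0 addr0.
by rewrite mulrAC ler_pdivrMr// mulrC [I22 * _]mulrC.
Qed.

End AgmIntegral.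

(** * Supermodularity and first-order expansion *)

Section AgmSupermodular.
Context {R : realType}.
Notation mu := (@lebesgue_measure R).
Implicit Types (a b c z x P Q : R).

(** Larger parameters make the integrand smaller, and more so for small z: the
    factor (t^2 + a) / (t^2 + a') increases with t. *)
Lemma agm_kernel_ratio a b a' b' (s t : R) : 0 < a -> 0 < b ->
  a <= a' -> b <= b' -> 0 <= s <= t -> t <= 1 ->
  (Num.sqrt (quartic (a' + b') (a' * b') s))^-1 *
    (Num.sqrt (quartic (a + b) (a * b) t))^-1 <=
  (Num.sqrt (quartic (a' + b') (a' * b') t))^-1 *
    (Num.sqrt (quartic (a + b) (a * b) s))^-1.
Proof.
move=> a0 b0 aa' bb' /andP[s0 st] t1.
have a'0 := lt_le_trans a0 aa'; have b'0 := lt_le_trans b0 bb'.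
rewrite -!invfM lef_pV2 ?posrE ?mulr_gt0 ?sqrtr_gt0 ?quartic_factor_gt0//.
rewrite -!sqrtrM; try exact/ltW/quartic_factor_gt0.
rewrite ler_wsqrtr//.
have W0 := @weighted_squares_gt0 R.
have factor c c' : 0 < c -> c <= c' ->
    (c' * (1 - t) ^+ 2 + t ^+ 2) * (c * (1 - s) ^+ 2 + s ^+ 2) <=
    (c' * (1 - s) ^+ 2 + s ^+ 2) * (c * (1 - t) ^+ 2 + t ^+ 2).
  move=> c0 cc'; rewrite -subr_ge0.
  have -> : (c' * (1 - s) ^+ 2 + s ^+ 2) * (c * (1 - t) ^+ 2 + t ^+ 2) -
      (c' * (1 - t) ^+ 2 + t ^+ 2) * (c * (1 - s) ^+ 2 + s ^+ 2) =
      (c' - c) * (((1 - s) * t) ^+ 2 - ((1 - t) * s) ^+ 2) by ring.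
  rewrite mulr_ge0 ?subr_ge0// lerXn2r// ?nnegrE ?mulr_ge0//; nra.
rewrite !quartic_factor mulrACA [leRHS]mulrACA.
by apply: ler_pM; rewrite ?factor// mulr_ge0// ltW// W0.
Qed.

(** If the two arguments, as functions on a two-by-two lattice, increase along
    the lattice and are submodular, then so is the logarithm of
    (t^2 + a) (t^2 + b) for each t, and the integrals are log-supermodular. *)
Lemma agm_integral_supermodular a11 a12 a21 a22 b11 b12 b21 b22 :
  0 < a11 -> a11 <= a12 -> a11 <= a21 -> a11 <= a22 -> a11 + a22 <= a12 + a21 ->
  0 < b11 -> b11 <= b12 -> b11 <= b21 -> b11 <= b22 -> b11 + b22 <= b12 + b21 ->
  agm_integral a12 b12 * agm_integral a21 b21 <=
  agm_integral a11 b11 * agm_integral a22 b22.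
Proof.
move=> a0 a1 a2 a3 a4 b0 b1 b2 b3 b4.
have [a12_0 a21_0 a22_0] : [/\ 0 < a12, 0 < a21 & 0 < a22].
  by split; exact: lt_le_trans a0 _.
have [b12_0 b21_0 b22_0] : [/\ 0 < b12, 0 < b21 & 0 < b22].
  by split; exact: lt_le_trans b0 _.
apply: chebyshev_unit_segment; try by move=> z _; exact: agm_kernel_continuous.
- by move=> z _; rewrite invr_gt0 sqrtr_gt0 quartic_factor_gt0.
- by move=> s t st t1; exact: agm_kernel_ratio.
- by move=> s t st t1; exact: agm_kernel_ratio.
- move=> z _; rewrite -!invfM lef_pV2 ?posrE ?mulr_gt0 ?sqrtr_gt0
  ?quartic_factor_gt0//.
  rewrite -!sqrtrM; try exact/ltW/quartic_factor_gt0.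
rewrite ler_wsqrtr//.
  have factor c11 c12 c21 c22 : 0 < c11 -> c11 <= c12 -> c11 <= c21 ->
      c11 + c22 <= c12 + c21 ->
      (c11 * (1 - z) ^+ 2 + z ^+ 2) * (c22 * (1 - z) ^+ 2 + z ^+ 2) <=
      (c12 * (1 - z) ^+ 2 + z ^+ 2) * (c21 * (1 - z) ^+ 2 + z ^+ 2).
    move=> c0 c1 c2 c4.
    have cc : c11 * c22 <= c12 * c21 by nra.
    rewrite -subr_ge0.
    have -> : (c12 * (1 - z) ^+ 2 + z ^+ 2) * (c21 * (1 - z) ^+ 2 + z ^+ 2) -
       (c11 * (1 - z) ^+ 2 + z ^+ 2) * (c22 * (1 - z) ^+ 2 + z ^+ 2) =
       (c12 * c21 - c11 * c22) * ((1 - z) ^+ 2) ^+ 2 +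
       (c12 + c21 - (c11 + c22)) * (z * (1 - z)) ^+ 2 by ring.
    by rewrite addr_ge0// mulr_ge0 ?sqr_ge0 ?subr_ge0.
  rewrite !quartic_factor mulrACA [leRHS]mulrACA.
  by apply: ler_pM; rewrite ?factor// mulr_ge0// ltW// weighted_squares_gt0.
- exact: agm_integral_gt0.
Qed.

(** Tangent line of e |-> 1 / sqrt e at e0, with a remainder that is uniform on
    e >= m^2. *)
Lemma invsqrt_taylor (m e e0 : R) : 0 < m -> m ^+ 2 <= e -> m ^+ 2 <= e0 ->
  `|(Num.sqrt e)^-1 - (Num.sqrt e0)^-1 - - (2 * e0 * Num.sqrt e0)^-1 * (e - e0)|
    <= (e - e0) ^+ 2 / (2 * m ^+ 5).
Proof.
move=> m0 me me0.
have m20 : 0 < m ^+ 2 by rewrite exprn_gt0.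
have sqr_form u : m ^+ 2 <= u -> exists2 s, m <= s & u = s ^+ 2.
  move=> mu_; exists (Num.sqrt u).
    by rewrite -(ger0_norm (ltW m0)) -sqrtr_sqr ler_wsqrtr.
  by rewrite sqr_sqrtr// ltW// (lt_le_trans m20).
have [s ms ->] := sqr_form _ me; have [t mt ->] := sqr_form _ me0.
have s0 := lt_le_trans m0 ms; have t0 := lt_le_trans m0 mt.
rewrite !sqrtr_sqr (gtr0_norm s0) (gtr0_norm t0).
have -> : s^-1 - t^-1 - - (2 * t ^+ 2 * t)^-1 * (s ^+ 2 - t ^+ 2) =
  (s ^+ 2 - t ^+ 2) ^+ 2 * ((s + 2 * t) / (2 * s * t ^+ 3 * (s + t) ^+ 2)).
  by field; rewrite !gt_eqF// addr_gt0.
have st0 : 0 < s + t by rewrite addr_gt0.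
have q0 : 0 <= (s + 2 * t) / (2 * s * t ^+ 3 * (s + t) ^+ 2).
  by rewrite divr_ge0 ?addr_ge0 ?mulr_ge0 ?exprn_ge0 ?ltW.
rewrite ger0_norm ?(mulr_ge0 (sqr_ge0 _) q0)// ler_wpM2l ?sqr_ge0//.
apply: (@le_trans _ _ (2 / (2 * s * t ^+ 3 * (s + t)))).
  have -> : (s + 2 * t) / (2 * s * t ^+ 3 * (s + t) ^+ 2) =
     (s + 2 * t) / (s + t) / (2 * s * t ^+ 3 * (s + t)).
    by field; rewrite !gt_eqF.
  apply: ler_wpM2r; first by rewrite invr_ge0 !mulr_ge0 ?exprn_ge0 ?ltW.
  by rewrite ler_pdivrMr//; lra.
have -> : 2 / (2 * s * t ^+ 3 * (s + t)) = (s * t ^+ 3 * (s + t))^-1.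
  by field; rewrite !gt_eqF.
rewrite lef_pV2 ?posrE ?mulr_gt0 ?exprn_gt0//.
have -> : 2 * m ^+ 5 = m * m ^+ 3 * (m + m) by ring.
have m3 : m ^+ 3 <= t ^+ 3 by rewrite lerXn2r// nnegrE ltW.
have m_ge0 := ltW m0; have m3_ge0 : 0 <= m ^+ 3 by exact: exprn_ge0.
apply: ler_pM; last exact: lerD.
- exact: mulr_ge0.
- exact: addr_ge0.
- exact: ler_pM.
Qed.

(** [quartic P Q z] is affine in (P, Q) with coefficients at most 1, so that
    the pointwise Taylor estimate integrates to a first-order expansion in
    (P, Q); the coefficients A and B are the partial derivatives. *)
Lemma quartic_integral_expansion P0 Q0 (m : R) : 0 < m ->
  (forall z, 0 <= z <= 1 -> m ^+ 2 <= quartic P0 Q0 z) ->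
  exists A B, forall P Q,
    (forall z, 0 <= z <= 1 -> m ^+ 2 <= quartic P Q z) ->
  `|quartic_integral P Q - quartic_integral P0 Q0 -
      (A * (P - P0) + B * (Q - Q0))| <=
    (`|P - P0| + `|Q - Q0|) ^+ 2 / (2 * m ^+ 5).
Proof.
move=> m0 E0.
have m20 : 0 < m ^+ 2 by rewrite exprn_gt0.
pose g z : R := - (2 * quartic P0 Q0 z * Num.sqrt (quartic P0 Q0 z))^-1.
pose g1 z : R := g z * (z ^+ 2 * (1 - z) ^+ 2).
pose g2 z : R := g z * (1 - z) ^+ 4.
have cg z : 0 <= z <= 1 -> {for z, continuous g}.
  move=> /E0 Ez; have Ez0 := lt_le_trans m20 Ez.
  apply: continuousN; apply: continuousV.
    by rewrite gt_eqF// !mulr_gt0// sqrtr_gt0.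
  apply: continuousM.
    by apply: continuousM; [exact: cvg_cst|exact: quartic_continuous].
  by apply: continuous_comp; [exact: quartic_continuous|exact: sqrt_continuous].
have cg1 z : 0 <= z <= 1 -> {for z, continuous g1}.
  move=> /cg gz; apply: continuousM => //.
  by apply: is_derive_continuous; exact: derivableP.
have cg2 z : 0 <= z <= 1 -> {for z, continuous g2}.
  move=> /cg gz; apply: continuousM => //.
  by apply: is_derive_continuous; exact: derivableP.
exists (\int[mu]_(z in `[0, 1]) g1 z), (\int[mu]_(z in `[0, 1]) g2 z) => P Q E.
pose k P Q z : R := (Num.sqrt (quartic P Q z))^-1.
have ck P' Q' : (forall z, 0 <= z <= 1 -> m ^+ 2 <= quartic P' Q' z) ->
    forall z, 0 <= z <= 1 -> {for z, continuous (k P' Q')}.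
  move=> E' z /E' Ez; apply: invsqrt_continuous;
    first exact: quartic_continuous.
  exact: lt_le_trans Ez.
pose c := (`|P - P0| + `|Q - Q0|) ^+ 2 / (2 * m ^+ 5).
pose l z := g1 z * (P - P0) + g2 z * (Q - Q0).
have cl z : 0 <= z <= 1 -> {for z, continuous l}.
  move=> z01; apply: continuousD; apply: continuousM; try exact: cvg_cst.
    exact: cg1.
  exact: cg2.
have ckk z : 0 <= z <= 1 -> {for z, continuous (fun z => k P Q z - k P0 Q0 z)}.
  by move=> z01; apply: continuousB; apply: ck.
have cr z : 0 <= z <= 1 ->
  {for z, continuous (fun z => k P Q z - k P0 Q0 z - l z)}.
  by move=> z01; apply: continuousB; [exact: ckk|exact: cl].
have -> : quartic_integral P Q - quartic_integral P0 Q0 -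
   ((\int[mu]_(z in `[0, 1]) g1 z) * (P - P0) +
    (\int[mu]_(z in `[0, 1]) g2 z) * (Q - Q0)) =
   \int[mu]_(z in `[0, 1]) (k P Q z - k P0 Q0 z - l z).
  rewrite RintegralB//; [|exact: segment_integrable..].
  rewrite RintegralB//; [|by apply: segment_integrable; exact: ck..].
  rewrite RintegralD//; first by rewrite !RintegralZr//;
    exact: segment_integrable.
    apply: segment_integrable => z z01; apply: continuousM; last exact: cvg_cst.
    exact: cg1.
  apply: segment_integrable => z z01; apply: continuousM; last exact: cvg_cst.
  exact: cg2.
apply: (le_trans (le_normr_Rintegral _ _)) => //;
  first exact: segment_integrable.
rewrite -/c -[leRHS]unit_segment_integral_cst; apply: le_Rintegral => //.
- apply: segment_integrable => z z01; apply: continuous_comp; first exact: cr.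
  exact: norm_continuous.
- by apply: segment_integrable => z _; exact: cvg_cst.
- move=> z; rewrite /= in_itv/= => z01.
  have z2 : `|z ^+ 2 * (1 - z) ^+ 2| <= 1.
    rewrite ger0_norm; last by rewrite mulr_ge0 ?sqr_ge0.
    by apply: mulr_ile1; rewrite ?sqr_ge0// exprn_ile1//; move: z01; lra.
  have y4 : `|(1 - z) ^+ 4| <= 1.
    by rewrite normrX exprn_ile1// ger0_norm; move: z01; lra.
  have dE : quartic P Q z - quartic P0 Q0 z =
      (z ^+ 2 * (1 - z) ^+ 2) * (P - P0) + (1 - z) ^+ 4 * (Q - Q0).
    by rewrite /quartic; ring.
  have -> : l z = g z * (quartic P Q z - quartic P0 Q0 z).
    by rewrite dE /l /g1 /g2; ring.
  apply: (le_trans (invsqrt_taylor m0 (E _ z01) (E0 _ z01))).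
  apply: ler_wpM2r; first by rewrite invr_ge0 !mulr_ge0 ?exprn_ge0 ?ltW.
  rewrite -[leLHS]ger0_norm ?sqr_ge0// normrX lerXn2r ?nnegrE ?addr_ge0//.
  rewrite dE; move: (z ^+ 2 * _) ((1 - z) ^+ 4) z2 y4 => u v u1 v1.
  by rewrite (le_trans (ler_normD _ _))// !normrM lerD// ler_piMl.
Qed.

End AgmSupermodular.

(** * Differentiability of the normal form *)

Section AgmDerivable.
Context {R : realType}.
Implicit Types (a b c z x P Q : R).

(** A bound from below that is uniform in z and stable under small changes of
    the parameters; it comes from 1 = (z + (1 - z))^2 and the Cauchy-Schwarz
    inequality. *)
Lemma quartic_factor_ge (u v : R) a b z : 0 < u -> 0 < v -> u <= a -> v <= b ->
  u / (1 + u) * (v / (1 + v)) <= quartic (a + b) (a * b) z.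
Proof.
move=> u0 v0 ua vb; rewrite quartic_factor.
have factor c d : 0 < c -> c <= d -> c / (1 + c) <= d * (1 - z) ^+ 2 + z ^+ 2.
  move=> c0 cd; apply: (@le_trans _ _ (c * (1 - z) ^+ 2 + z ^+ 2)); last first.
    by rewrite lerD2r ler_wpM2r// sqr_ge0.
  rewrite ler_pdivrMr ?addr_gt0// -subr_ge0.
  have -> : (c * (1 - z) ^+ 2 + z ^+ 2) * (1 + c) - c = (z - c * (1 - z)) ^+ 2.
    by ring.
  exact: sqr_ge0.
by apply: ler_pM; rewrite ?factor// divr_ge0 ?addr_ge0// ltW.
Qed.

Lemma agm_integral_derivable (a b : R -> R) x :
  derivable a x 1 -> derivable b x 1 -> 0 < a x -> 0 < b x ->
  derivable (fun y => agm_integral (a y) (b y)) x 1.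
Proof.
move=> da db a0 b0.
(* near x the parameters stay above half their values at x, which bounds the
   quartics below by m^2 *)
pose u := a x / 2; pose v := b x / 2.
have u0 : 0 < u by rewrite divr_gt0.
have v0 : 0 < v by rewrite divr_gt0.
pose m := Num.sqrt (u / (1 + u) * (v / (1 + v))).
have w0 : 0 < u / (1 + u) * (v / (1 + v)).
  by rewrite mulr_gt0// divr_gt0// addr_gt0.
have m0 : 0 < m by rewrite sqrtr_gt0.
have mE : m ^+ 2 = u / (1 + u) * (v / (1 + v)) by rewrite sqr_sqrtr// ltW.
have ux : u <= a x by rewrite /u; lra.
have vx : v <= b x by rewrite /v; lra.
have [A [B HAB]] := @quartic_integral_expansion _ (a x + b x) (a x * b x) m m0
  ltac:(by move=> z _; rewrite mE quartic_factor_ge).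
pose P y := a y + b y; pose Q y := a y * b y.
have [dP dQ] : derivable P x 1 /\ derivable Q x 1.
  by split; [exact: (derivableD da db)|exact: (derivableM da db)].
move: (dP) (dQ) => /cvg_ex[/= P' cP] /cvg_ex[/= Q' cQ].
pose sh (h : R) := h *: 1 + x.
have csh : sh h @[h --> 0^'] --> x.
  apply: cvg_within_filter.
  suff : sh h @[h --> (0 : R)] --> 0 *: 1 + x by rewrite scale0r add0r.
  by apply: cvgD; [exact: cvgZr_tmp|exact: cvg_cst].
have ca : a (sh h) @[h --> 0^'] --> a x.
  have cax : {for x, continuous a}.
    exact: (is_derive_continuous (derivableP da)).
  exact: (cvg_comp _ _ csh cax).
have cb : b (sh h) @[h --> 0^'] --> b x.
  have cbx : {for x, continuous b}.
    exact: (is_derive_continuous (derivableP db)).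
  exact: (cvg_comp _ _ csh cbx).
pose K y := agm_integral (a y) (b y).
pose p (h : R) := h^-1 *: (P (sh h) - P x).
pose q (h : R) := h^-1 *: (Q (sh h) - Q x).
pose r (h : R) := h^-1 *: (K (sh h) - K x) - (A * p h + B * q h).
pose bd (h : R) := (`|p h| + `|q h|) * (`|p h| + `|q h|) * `|h| / (2 * m ^+ 5).
have cbd : bd h @[h --> 0^'] --> (0 : R).
  suff : bd h @[h --> 0^'] -->
      (`|P'| + `|Q'|) * (`|P'| + `|Q'|) * `|0 : R| / (2 * m ^+ 5).
    by rewrite normr0 mulr0 mul0r.
  apply: cvgM; last exact: cvg_cst.
  apply: cvgM.
    have cpq : `|p h| + `|q h| @[h --> 0^'] --> `|P'| + `|Q'|.
      by apply: cvgD; [exact: (cvg_norm cP)|exact: (cvg_norm cQ)].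
    exact: (cvgM cpq cpq).
  apply: cvg_norm; exact: cvg_within_filter.
have r_le : \forall h \near 0^', `|r h| <= bd h.
  near=> h.
  have h0 : h != 0 by near: h; exact: nbhs_dnbhs_neq.
  have uh : u <= a (sh h).
    apply: ltW; near: h; apply: (cvgr_gt _ ca); rewrite /u; lra.
  have vh : v <= b (sh h).
    apply: ltW; near: h; apply: (cvgr_gt _ cb); rewrite /v; lra.
  have := HAB (P (sh h)) (Q (sh h)) ltac:(by move=> z _;
    rewrite mE quartic_factor_ge).
  move=> HABh.
  have -> : r h = h^-1 * (K (sh h) - K x -
      (A * (P (sh h) - P x) + B * (Q (sh h) - Q x))).
    by rewrite /r /p /q /GRing.scale /=; ring.
  rewrite normrM; apply: (le_trans (ler_wpM2l (normr_ge0 _) HABh)).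
  have -> : P (sh h) - P x = h * p h by rewrite /p /GRing.scale /= mulVKf.
  have -> : Q (sh h) - Q x = h * q h by rewrite /q /GRing.scale /= mulVKf.
  rewrite /bd; move: (p h) (q h) => ph qh.
  rewrite !normrM normfV -mulrDr exprMn.
  have hn0 : `|h| != 0 by rewrite normr_eq0.
  by rewrite le_eqVlt; apply/orP; left; apply/eqP; field; rewrite hn0 gt_eqF.
have cr : r h @[h --> 0^'] --> (0 : R).
  apply: (@squeeze_cvgr _ _ _ _ (fun h => - bd h) bd).
  - near=> h; rewrite -ler_norml; near: h; exact: r_le.
  - by rewrite -[X in _ --> X]oppr0; exact: (cvgN cbd).
  - exact: cbd.
apply/cvg_ex; exists (0 + (A * P' + B * Q')).
rewrite /= (_ : (fun h => _) = (fun h => r h + (A * p h + B * q h))).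
  apply: cvgD => //; apply: cvgD; apply: cvgM => //; exact: cvg_cst.
by apply/funext => h; rewrite /r subrK.
Unshelve. all: by end_near. Qed.

End AgmDerivable.

(** * Nondegenerate components and periods *)

Section Components.
Context {R : realType}.
Notation mu := (@lebesgue_measure R).
Implicit Types (A : set R) (a b c e x : R).

(** A connected set of reals is an interval, so a component of A cannot jump
    over a gap of A. *)
Lemma segment_component A a b x : `[a, b] `<=` A -> a <= x <= b ->
  (forall y, A y -> y < a -> exists2 t, y <= t <= a & ~ A t) ->
  (forall y, A y -> b < y -> exists2 t, b <= t <= y & ~ A t) ->
  connected_component A x = `[a, b]%classic.
Proof.
move=> abA xab gapl gapr.
have Ax : A x by apply: abA; rewrite /= in_itv.
have /connected_intervalP itvC := @component_connected _ A x.
have Cx := connected_component_refl Ax.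
apply/seteqP; split => y; last first.
  move=> yab; apply: (@connected_component_max _ A `[a, b]%classic x) => //.
  exact: segment_connected.
move=> Cy; rewrite /= in_itv/=.
have Ay := connected_component_sub Cy.
case/andP: xab => ax xb.
apply/andP; split; rewrite leNgt; apply/negP => lty.
  have [t /andP[yt ta]] := gapl _ Ay lty; apply.
  apply: (@connected_component_sub _ A x); apply: (itvC y x) => //.
  by rewrite yt (le_trans ta).
have [t /andP[bt ty]] := gapr _ Ay lty; apply.
apply: (@connected_component_sub _ A x); apply: (itvC x y) => //.
by rewrite ty (le_trans xb).
Qed.

Lemma segment_inj (I : R * R) a b : I.1 < I.2 ->
  `[I.1, I.2]%classic = `[a, b]%classic -> I = (a, b).
Proof.
case: I => i j /= ij E.
have ab_i : `[a, b]%classic i by rewrite -E /= in_itv/= lexx ltW.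
have ab_j : `[a, b]%classic j by rewrite -E /= in_itv/= lexx ltW.
move: ab_i ab_j; rewrite /= !in_itv/= => /andP[ai ib] /andP[aj jb].
have ij_a : `[i, j]%classic a by rewrite E /= in_itv/= lexx (le_trans ai).
have ij_b : `[i, j]%classic b by rewrite E /= in_itv/= lexx (le_trans ai).
move: ij_a ij_b; rewrite /= !in_itv/= => /andP[ia _] /andP[_ bj].
by congr pair; apply/eqP; rewrite eq_le ?ia ?ai ?bj ?jb.
Qed.

(** The period is insensitive to the choice of the component if both segments
    give the same value.  Either segment may be degenerate, which accounts for
    the isolated zeros of W at 1. *)
Lemma period_two_segments A (W : R -> R) a b c e (v : R) :
  A = `[a, b]%classic `|` `[c, e]%classic -> b < c ->
  (a < b \/ c < e) ->
  (a < b -> 2 * \int[mu]_(x in `[a, b]) (Num.sqrt (W x))^-1 = v) ->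
  (c < e -> 2 * \int[mu]_(x in `[c, e]) (Num.sqrt (W x))^-1 = v) ->
  period A W = v.
Proof.
move=> AE bc abce vab vce.
have nA t : b < t < c -> ~ A t.
  by move=> /andP[bt tc]; rewrite AE => -[]; rewrite /= in_itv/=; lra.
have mid : b < (b + c) / 2 < c by lra.
have compl x : a <= x <= b -> connected_component A x = `[a, b]%classic.
  move=> xab; apply: segment_component => //.
  - by rewrite AE => y; left.
  - by move=> y; rewrite AE => -[]; rewrite /= in_itv/=; lra.
  - move=> y; rewrite {1}AE => -[]; rewrite /= in_itv/= => yA yb.
      by move: yA yb; clear; lra.
    by exists ((b + c) / 2); [lra|exact: nA].
have compr x : c <= x <= e -> connected_component A x = `[c, e]%classic.
  move=> xce; apply: segment_component => //.
  - by rewrite AE => y; right.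
  - move=> y; rewrite {1}AE => -[]; rewrite /= in_itv/= => yA yb; last first.
      by move: yA yb; clear; lra.
    by exists ((b + c) / 2); [lra|exact: nA].
  - by move=> y; rewrite AE => -[]; rewrite /= in_itv/=; lra.
rewrite /period; set I := xget _ _.
have : nondegenerate_component A I.
  apply: (@xgetPex _ _ [set I | nondegenerate_component A I]).
  case: abce => [ab|ce].
    exists (a, b); split => //=; exists a; last first.
      by rewrite compl// lexx ltW.
    by rewrite AE; left; rewrite /= in_itv/= lexx ltW.
  exists (c, e); split => //=; exists c; last first.
    by rewrite compr// lexx ltW.
  by rewrite AE; right; rewrite /= in_itv/= lexx ltW.
move=> [I12 [x Ax]].
have : a <= x <= b \/ c <= x <= e.
  by move: Ax; rewrite AE => -[]; rewrite /= in_itv/=; [left|right].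
case=> [/compl ->|/compr ->] /(segment_inj I12) IE.
  by move: I12; rewrite IE /=; exact: vab.
by move: I12; rewrite IE /=; exact: vce.
Qed.

Lemma period_segment A (W : R -> R) a b :
  A = `[a, b]%classic -> a < b ->
  period A W = 2 * \int[mu]_(x in `[a, b]) (Num.sqrt (W x))^-1.
Proof.
move=> AE ab; apply: (@period_two_segments _ _ a b (b + 2) (b + 1)) => //.
(* the second segment is empty: its right end is below its left end *)
- rewrite AE; apply/seteqP; split => y; first by left.
  by case=> //; rewrite /= in_itv/=; lra.
- lra.
- by left.
- lra.
Qed.

End Components.

(** * The Jacobi periods in normal form *)

Section JacobiPeriods.
Context {R : realType}.
Notation mu := (@lebesgue_measure R).
Implicit Types (v M d f s g x : R).

Lemma segment_integral_agm al be (q0 q1 q2 A B : R) (W q : R -> R) :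
  q = (fun x => q2 * x ^+ 2 + q1 * x + q0) -> al < be ->
  (forall x, al <= x <= be -> 0 < q x) ->
  (forall x, al <= x <= be -> W x = (x - al) * (be - x) * q x) ->
  2 * q2 * al * be + q1 * (al + be) + 2 * q0 = A + B -> q al * q be = A * B ->
  2 * \int[mu]_(x in `[al, be]) (Num.sqrt (W x))^-1 = 4 * agm_integral A B.
Proof.
move=> qE ab q_gt0 WE CE QE.
by rewrite (segment_integral_quartic qE ab q_gt0 WE) CE QE /agm_integral mulrA
  -natrM.
Qed.

Lemma segment_integral_landen al be (q0 q1 q2 P b : R) (W q : R -> R) :
  q = (fun x => q2 * x ^+ 2 + q1 * x + q0) -> al < be ->
  (forall x, al <= x <= be -> 0 < q x) ->
  (forall x, al <= x <= be -> W x = (x - al) * (be - x) * q x) ->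
  2 * q2 * al * be + q1 * (al + be) + 2 * q0 = P -> q al * q be = b ^+ 2 ->
  0 < b -> 0 < P + 2 * b ->
  2 * \int[mu]_(x in `[al, be]) (Num.sqrt (W x))^-1 =
  4 * agm_integral ((P + 2 * b) / 4) b.
Proof.
move=> qE ab q_gt0 WE CE QE b0 Pb.
by rewrite (segment_integral_quartic qE ab q_gt0 WE) CE QE landen//
  /agm_integral mulrA -natrM.
Qed.

Definition coupling v0 d : R := v0 / (2 * d).

Lemma W_plus_factor v0 M d f s x : 0 < v0 -> 0 < d ->
  f = M ^+ 2 + d ^+ 2 / 4 - s ^+ 2 / 4 ->
  W_plus v0 M (J0_of v0 d) (F0_of v0 d f) x =
  (coupling v0 d * d ^+ 2) *
    ((x ^+ 2 - 1) * ((x - (2 * M - s) / d) * ((2 * M + s) / d - x))).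
Proof.
move=> v_gt0 d_gt0 ->; rewrite /W_plus /J0_of /F0_of /coupling.
by field; rewrite !gt_eqF.
Qed.

Lemma W_minus_factor v0 M d f s x : 0 < v0 -> 0 < d ->
  f = M ^+ 2 + d ^+ 2 / 4 - s ^+ 2 / 4 ->
  W_minus v0 M (J0_of v0 d) (F0_of v0 d f) x =
  (coupling v0 d * d ^+ 2) *
    ((1 - x ^+ 2) * ((x - (2 * M - s) / d) * (x - (2 * M + s) / d))).
Proof.
move=> v_gt0 d_gt0 ->; rewrite /W_minus /J0_of /F0_of /coupling.
by field; rewrite !gt_eqF.
Qed.

Lemma W_minus_square v0 M d f x : 0 < v0 -> 0 < d ->
  W_minus v0 M (J0_of v0 d) (F0_of v0 d f) x =
  coupling v0 d *
    ((1 - x ^+ 2) * ((d * x - 2 * M) ^+ 2 + (4 * f - 4 * M ^+ 2 - d ^+ 2))).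
Proof.
move=> v_gt0 d_gt0; rewrite /W_minus /J0_of /F0_of /coupling.
by field; rewrite !gt_eqF.
Qed.

(** Here (2 M - s) / d is in ]-1, 1[.  If (2 M + s) / d < 1 there are two
    intervals of motion; both have the same period because the cross-ratio of
    the four roots is the same seen from either of them.  Otherwise the second
    interval shrinks to the point 1. *)
Lemma tau_minus_split v0 M d f s : 0 < v0 -> 0 < d -> 0 < s ->
  f = M ^+ 2 + d ^+ 2 / 4 - s ^+ 2 / 4 ->
  s < 2 * M + d -> 2 * M - d < s ->
  tau_minus v0 M d f =
  4 * agm_integral (coupling v0 d * (4 * (s * d)))
                   (coupling v0 d * (2 * (s * d) + 2 * d ^+ 2 - 4 * f)).
Proof.
move=> v_gt0 d_gt0 s_gt0 fE s_lt s_gt.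
have c_gt0 : 0 < coupling v0 d by rewrite divr_gt0 ?mulr_gt0.
have cd_gt0 : 0 < coupling v0 d * d ^+ 2 by rewrite mulr_gt0 ?exprn_gt0.
have WE x := W_minus_factor x v_gt0 d_gt0 fE.
pose xm := (2 * M - s) / d; pose xp := (2 * M + s) / d.
have dxm : d * xm = 2 * M - s by rewrite mulrC divfK// gt_eqF.
have dxp : d * xp = 2 * M + s by rewrite mulrC divfK// gt_eqF.
have xm_gt : -1 < xm by rewrite -(ltr_pM2l d_gt0) dxm; lra.
have xm_lt : xm < 1 by rewrite -(ltr_pM2l d_gt0) dxm; lra.
have xmp : xm < xp by rewrite -(ltr_pM2l d_gt0) dxm dxp; lra.
rewrite -/xm -/xp in WE.
set c := coupling v0 d in c_gt0 cd_gt0 WE *; clearbody c.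
apply: (@period_two_segments _ _ _ (-1) xm (Num.min xp 1) 1).
- apply/seteqP; split => x /=; rewrite WE (pmulr_rge0 _ cd_gt0) !in_itv/=.
    move=> [/andP[x1 x2] W0]; have [xxm|xmx] := leP x xm.
      by left; rewrite x1.
    right; rewrite x2 andbT ge_min; have [//|xxp] := leP xp x.
    rewrite leNgt; apply/negP => x_lt; move: W0.
    have h1 : 0 < 1 - x ^+ 2 by nra.
    have h2 : 0 < x - xm by lra.
    by rewrite (pmulr_rge0 _ h1) (pmulr_rge0 _ h2); lra.
  move=> [/andP[x1 x2]|/andP[x1 x2]]; split; try by apply/andP; split; lra.
  + apply: mulr_ge0; first nra.
    by rewrite -mulrNN mulr_ge0//; lra.
  + apply/andP; split => //; move: x1; rewrite ge_min => /orP[]; lra.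
  + move: x1; rewrite ge_min => /orP[x1|x1].
      have x3 : -1 <= x by lra.
      by apply: mulr_ge0; [nra|apply: mulr_ge0; lra].
    have -> : x = 1 by lra.
    by rewrite expr1n subrr mul0r.
- by rewrite lt_min xmp.
- by left.
- move=> _; apply: (@segment_integral_agm _ _ (c * d ^+ 2 * xp)
    (- (c * d ^+ 2 * (1 + xp))) (c * d ^+ 2) _ _ _ _ erefl) => //.
  + move=> x /andP[x1 x2].
    rewrite (_ : _ + _ = c * d ^+ 2 * ((1 - x) * (xp - x))); last ring.
    by rewrite mulr_gt0// mulr_gt0//; lra.
  + by move=> x _; rewrite WE; ring.
  + rewrite fE /xm /xp; field; exact: lt0r_neq0.
  + rewrite fE /xm /xp; field; exact: lt0r_neq0.
- rewrite gt_min ltxx orbF => xp1; rewrite (min_idPl (ltW xp1)).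
  apply: (@segment_integral_agm _ _ (- (c * d ^+ 2 * xm))
    (c * d ^+ 2 * (1 - xm)) (c * d ^+ 2) _ _ _ _ erefl) => //.
  + move=> x /andP[x1 x2].
    rewrite (_ : _ + _ = c * d ^+ 2 * ((x + 1) * (x - xm))); last ring.
    by rewrite mulr_gt0// mulr_gt0//; lra.
  + by move=> x _; rewrite WE; ring.
  + rewrite fE /xm /xp; field; exact: lt0r_neq0.
  + rewrite fE /xm /xp; field; exact: lt0r_neq0.
Qed.

(** Here -1 < (2 M - s) / d < 1 < (2 M + s) / d. *)
Lemma tau_plus_split v0 M d f s : 0 < v0 -> 0 < d ->
  f = M ^+ 2 + d ^+ 2 / 4 - s ^+ 2 / 4 ->
  s < 2 * M + d -> 2 * M - d < s -> d - 2 * M < s ->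
  tau_plus v0 M d f =
  4 * agm_integral (coupling v0 d * (4 * (s * d)))
                   (coupling v0 d * (2 * (s * d) + 2 * d ^+ 2 - 4 * f)).
Proof.
move=> v_gt0 d_gt0 fE s_lt s_gt s_gt'.
have c_gt0 : 0 < coupling v0 d by rewrite divr_gt0 ?mulr_gt0.
have cd_gt0 : 0 < coupling v0 d * d ^+ 2 by rewrite mulr_gt0 ?exprn_gt0.
have WE x := W_plus_factor x v_gt0 d_gt0 fE.
pose xm := (2 * M - s) / d; pose xp := (2 * M + s) / d.
have dxm : d * xm = 2 * M - s by rewrite mulrC divfK// gt_eqF.
have dxp : d * xp = 2 * M + s by rewrite mulrC divfK// gt_eqF.
have xm_gt : -1 < xm by rewrite -(ltr_pM2l d_gt0) dxm; lra.
have xm_lt : xm < 1 by rewrite -(ltr_pM2l d_gt0) dxm; lra.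
have xp_gt : 1 < xp by rewrite -(ltr_pM2l d_gt0) dxp; lra.
rewrite -/xm -/xp in WE.
set c := coupling v0 d in c_gt0 cd_gt0 WE *; clearbody c.
rewrite /tau_plus (@period_segment _ _ _ 1 xp)//.
  apply: (@segment_integral_agm _ _ (- (c * d ^+ 2 * xm))
    (c * d ^+ 2 * (1 - xm)) (c * d ^+ 2) _ _ _ _ erefl) => //.
  + move=> x /andP[x1 x2].
    rewrite (_ : _ + _ = c * d ^+ 2 * ((x + 1) * (x - xm))); last ring.
    by rewrite mulr_gt0// mulr_gt0//; lra.
  + by move=> x _; rewrite WE; ring.
  + rewrite fE /xm /xp; field; exact: lt0r_neq0.
  + rewrite fE /xm /xp; field; exact: lt0r_neq0.
apply/seteqP; split => x /=; rewrite WE (pmulr_rge0 _ cd_gt0) !in_itv/=.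
  move=> [x1 W0]; rewrite x1/= leNgt; apply/negP => x_gt; move: W0.
  have h1 : 0 < x ^+ 2 - 1 by nra.
  have h2 : 0 < x - xm by lra.
  by rewrite (pmulr_rge0 _ h1) (pmulr_rge0 _ h2); lra.
move=> /andP[x1 x2]; split => //.
by apply: mulr_ge0; [nra|apply: mulr_ge0; lra].
Qed.

(** Here 1 < (2 M - s) / d, and 1 is an isolated point of the set where W is
    nonnegative. *)
Lemma tau_plus_landen v0 M d f s g : 0 < v0 -> 0 < d -> 0 < s ->
  f = M ^+ 2 + d ^+ 2 / 4 - s ^+ 2 / 4 -> s < 2 * M - d ->
  0 < g -> g ^+ 2 = f ^+ 2 - M ^+ 2 * d ^+ 2 -> 0 < 2 * f - d ^+ 2 + 2 * g ->
  tau_plus v0 M d f =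
  4 * agm_integral (coupling v0 d * (2 * f - d ^+ 2 + 2 * g))
                   (coupling v0 d * (4 * g)).
Proof.
move=> v_gt0 d_gt0 s_gt0 fE s_lt g_gt0 gE a_gt0.
have c_gt0 : 0 < coupling v0 d by rewrite divr_gt0 ?mulr_gt0.
have cd_gt0 : 0 < coupling v0 d * d ^+ 2 by rewrite mulr_gt0 ?exprn_gt0.
have WE x := W_plus_factor x v_gt0 d_gt0 fE.
pose xm := (2 * M - s) / d; pose xp := (2 * M + s) / d.
have dxm : d * xm = 2 * M - s by rewrite mulrC divfK// gt_eqF.
have dxp : d * xp = 2 * M + s by rewrite mulrC divfK// gt_eqF.
have xm_gt : 1 < xm by rewrite -(ltr_pM2l d_gt0) dxm; lra.
have xmp : xm < xp by rewrite -(ltr_pM2l d_gt0) dxm dxp; lra.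
rewrite -/xm -/xp in WE.
set c := coupling v0 d in c_gt0 cd_gt0 WE *; clearbody c.
apply: (@period_two_segments _ _ _ 1 1 xm xp) => //; last 2 first.
- by rewrite ltxx.
- move=> _.
  have -> : c * (2 * f - d ^+ 2 + 2 * g) =
      (c * (8 * f - 4 * d ^+ 2) + 2 * (c * (4 * g))) / 4.
    by field.
  apply: (@segment_integral_landen _ _ (- (c * d ^+ 2)) 0 (c * d ^+ 2)
    _ _ _ _ erefl) => //.
  + move=> x /andP[x1 x2].
    rewrite (_ : _ + _ = c * d ^+ 2 * (x ^+ 2 - 1)); last ring.
    by rewrite mulr_gt0//; nra.
  + by move=> x _; rewrite WE; ring.
  + rewrite fE /xm /xp; field; exact: lt0r_neq0.
  + rewrite !exprMn gE fE /xm /xp; field; exact: lt0r_neq0.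
  + by rewrite !mulr_gt0.
  + have -> : c * (8 * f - 4 * d ^+ 2) + 2 * (c * (4 * g)) =
      4 * (c * (2 * f - d ^+ 2 + 2 * g)) by ring.
    by rewrite !mulr_gt0.
- apply/seteqP; split => x /=; rewrite WE (pmulr_rge0 _ cd_gt0) !in_itv/=.
    move=> [x1' W0]; have [x1|x1] := leP x 1; first by left; rewrite x1'.
    right; move: W0; have h1 : 0 < x ^+ 2 - 1 by nra.
    rewrite (pmulr_rge0 _ h1) => W0.
    apply/andP; split; rewrite leNgt; apply/negP => xx; move: W0.
      have h2 : 0 < xp - x by lra.
      by rewrite (pmulr_lge0 _ h2); lra.
    have h2 : 0 < x - xm by lra.
    by rewrite (pmulr_rge0 _ h2); lra.
  move=> [/andP[x1 x2]|/andP[x1 x2]].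
    have -> : x = 1 by lra.
    by rewrite expr1n subrr mul0r.
  split; first lra.
  by apply: mulr_ge0; [nra|apply: mulr_ge0; lra].
- by right.
Qed.

(** The motion fills [-1, 1]; the other two roots may be real and outside
    [-1, 1], or complex.  This is why Landen's transformation is used. *)
Lemma tau_minus_landen v0 M d f g : 0 < v0 -> 0 < d ->
  (forall x, -1 <= x <= 1 ->
     0 < (d * x - 2 * M) ^+ 2 + (4 * f - 4 * M ^+ 2 - d ^+ 2)) ->
  0 < g -> g ^+ 2 = f ^+ 2 - M ^+ 2 * d ^+ 2 -> 0 < 2 * f - d ^+ 2 + 2 * g ->
  tau_minus v0 M d f =
  4 * agm_integral (coupling v0 d * (2 * f - d ^+ 2 + 2 * g))
                   (coupling v0 d * (4 * g)).
Proof.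
move=> v_gt0 d_gt0 q_gt0 g_gt0 gE a_gt0.
have c_gt0 : 0 < coupling v0 d by rewrite divr_gt0 ?mulr_gt0.
have WE x := W_minus_square M f x v_gt0 d_gt0.
set c := coupling v0 d in c_gt0 WE *; clearbody c.
rewrite /tau_minus (@period_segment _ _ _ (-1) 1).
- have -> : c * (2 * f - d ^+ 2 + 2 * g) =
      (c * (8 * f - 4 * d ^+ 2) + 2 * (c * (4 * g))) / 4.
    by field.
  apply: (@segment_integral_landen _ _ (c * (4 * f - d ^+ 2))
    (- (c * (4 * (M * d)))) (c * d ^+ 2) _ _ _ _ erefl) => //.
  + move=> x /q_gt0 qx.
    rewrite (_ : _ + _ =
      c * ((d * x - 2 * M) ^+ 2 + (4 * f - 4 * M ^+ 2 - d ^+ 2))); last ring.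
    by rewrite mulr_gt0.
  + by move=> x _; rewrite WE; ring.
  + by ring.
  + by rewrite !exprMn gE; ring.
  + by rewrite !mulr_gt0.
  + have -> : c * (8 * f - 4 * d ^+ 2) + 2 * (c * (4 * g)) =
      4 * (c * (2 * f - d ^+ 2 + 2 * g)) by ring.
    by rewrite !mulr_gt0.
- apply/seteqP; split => x /=; rewrite in_itv/=; first by case.
  move=> x01; split => //; rewrite WE mulr_ge0 ?(ltW c_gt0)// mulr_ge0//.
    by nra.
  exact/ltW/q_gt0.
- lra.
Qed.

End JacobiPeriods.

(** * The two regimes *)

Section Regimes.
Context {R : realType}.
Implicit Types (M N d f c x : R).

(** Half the difference of the roots 2 M - s, 2 M + s of the quadratic factor in
    the variable d x. *)
Definition root_gap M d f : R := Num.sqrt (4 * M ^+ 2 + d ^+ 2 - 4 * f).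

(** The geometric mean of f - M d and f + M d, which are a quarter of the values
    of (d x - 2 M)^2 - s^2 at x = 1 and x = -1. *)
Definition root_mean M d f : R := Num.sqrt (f ^+ 2 - M ^+ 2 * d ^+ 2).

Definition low_range M d f := - M * d < f < f_s M d.
Definition high_range M d f := f_s M d < f.

Definition low_period c M d f : R :=
  4 * agm_integral (c * (4 * (root_gap M d f * d)))
                   (c * (2 * (root_gap M d f * d) + 2 * d ^+ 2 - 4 * f)).
Definition high_period c M d f : R :=
  4 * agm_integral (c * (2 * f - d ^+ 2 + 2 * root_mean M d f))
                   (c * (4 * root_mean M d f)).

(** Concavity of the square root.  After squaring, it says that
    X (X + p + q) <= (X + p) (X + q). *)
Lemma sqrt_submodular (X p q : R) : 0 <= X -> 0 <= p -> 0 <= q ->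
  Num.sqrt X + Num.sqrt (X + p + q) <= Num.sqrt (X + p) + Num.sqrt (X + q).
Proof.
move=> X0 p0 q0.
rewrite -(@ler_pXn2r _ 2) ?nnegrE ?addr_ge0 ?sqrtr_ge0//.
rewrite !sqrrD !sqr_sqrtr ?addr_ge0// -!sqrtrM ?addr_ge0//.
have : Num.sqrt (X * (X + p + q)) <= Num.sqrt ((X + p) * (X + q)).
  rewrite ler_wsqrtr//; nra.
lra.
Qed.

Lemma mean_inequality M d : M * d <= M ^+ 2 + d ^+ 2 / 4.
Proof.
rewrite -subr_ge0; have -> : M ^+ 2 + d ^+ 2 / 4 - M * d = (M - d / 2) ^+ 2.
  by field.
exact: sqr_ge0.
Qed.

Lemma f_s_le M d : f_s M d <= M ^+ 2 + d ^+ 2 / 4.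
Proof. by rewrite /f_s; case: ifP => // _; exact: mean_inequality. Qed.

Lemma f_s_ge M d : M * d <= f_s M d.
Proof. by rewrite /f_s; case: ifP => // _; exact: mean_inequality. Qed.

(** The inequalities express that, of the two roots (2 M - s) / d and
    (2 M + s) / d, the smaller one lies in ]-1, 1[. *)
Lemma low_regime M d f : 0 <= M -> 0 < d -> low_range M d f ->
  let s := root_gap M d f in
  [/\ 0 < s, f = M ^+ 2 + d ^+ 2 / 4 - s ^+ 2 / 4, s < 2 * M + d,
      2 * M - d < s & 0 < 2 * (s * d) + 2 * d ^+ 2 - 4 * f].
Proof.
move=> M0 d0 /andP[fl fu] s.
have D0 : 0 < 4 * M ^+ 2 + d ^+ 2 - 4 * f by have := f_s_le M d; lra.
have s0 : 0 < s by rewrite sqrtr_gt0.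
have s2 : s ^+ 2 = 4 * M ^+ 2 + d ^+ 2 - 4 * f by rewrite sqr_sqrtr// ltW.
have s_gt : 2 * M - d < s.
  move: fu; rewrite /f_s; case: ifPn => [dM fu|]; last by rewrite -ltNge; lra.
  by rewrite ltNge; apply/negP => sle; nra.
split => //; first by rewrite s2; field.
- by rewrite ltNge; apply/negP => sle; nra.
- have -> : 2 * (s * d) + 2 * d ^+ 2 - 4 * f =
    (s + d - 2 * M) * (s + d + 2 * M).
    have -> : f = (4 * M ^+ 2 + d ^+ 2 - s ^+ 2) / 4 by rewrite s2; field.
    by field.
  by rewrite mulr_gt0//; lra.
Qed.

(** The last clause says that the quadratic factor has no zero on [-1, 1]:
    either its vertex 2 M / d is to the right of 1 and its value at 1 is
    positive, or its discriminant is negative. *)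
Lemma high_regime M d f : 0 <= M -> 0 < d -> high_range M d f ->
  let g := root_mean M d f in
  [/\ 0 < f, 0 < g, g ^+ 2 = f ^+ 2 - M ^+ 2 * d ^+ 2,
      0 < 2 * f - d ^+ 2 + 2 * g &
      forall x, -1 <= x <= 1 ->
        0 < (d * x - 2 * M) ^+ 2 + (4 * f - 4 * M ^+ 2 - d ^+ 2)].
Proof.
move=> M0 d0 ff g; rewrite /high_range in ff.
have Mdf : M * d < f by apply: le_lt_trans ff; exact: f_s_ge.
have Md0 : 0 <= M * d by rewrite mulr_ge0// ltW.
have D0 : 0 < f ^+ 2 - M ^+ 2 * d ^+ 2.
  by rewrite -exprMn; nra.
have g0 : 0 < g by rewrite sqrtr_gt0.
have g2 : g ^+ 2 = f ^+ 2 - M ^+ 2 * d ^+ 2 by rewrite sqr_sqrtr// ltW.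
split => //.
- by lra.
- move: ff; rewrite /f_s; case: ifPn => [dM ff|]; first by nra.
  rewrite -ltNge => dM ff.
  have : d ^+ 2 / 4 - M ^+ 2 < g.
    rewrite ltNge; apply/negP => gle.
    have h1 : g ^+ 2 <= (d ^+ 2 / 4 - M ^+ 2) ^+ 2 by nra.
    have h2 : (M ^+ 2 + d ^+ 2 / 4) ^+ 2 < f ^+ 2 by nra.
    have h3 : (M ^+ 2 + d ^+ 2 / 4) ^+ 2 - M ^+ 2 * d ^+ 2 = (d ^+ 2 / 4 - M ^+
      2) ^+ 2 by field.
    by move: h1 h2 h3; rewrite g2; lra.
  by lra.
- move=> x /andP[x1 x2].
  move: ff; rewrite /f_s; case: ifPn => [dM ff|_ ff]; last first.
    by rewrite ltr_wpDl ?sqr_ge0//; lra.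
  have dx : d * x <= d by nra.
  have -> : (d * x - 2 * M) ^+ 2 + (4 * f - 4 * M ^+ 2 - d ^+ 2) =
    (2 * M - d * x) ^+ 2 - (2 * M - d) ^+ 2 + 4 * (f - M * d) by ring.
  rewrite ltr_wpDl//; last by lra.
  by rewrite subr_ge0 lerXn2r ?nnegrE//; lra.
Qed.

End Regimes.

(** * Regularity and monotonicity of the two period functions *)

Section PeriodMonotonicity.
Context {R : realType}.
Implicit Types (M N d f c x : R).

Lemma sqrt_derivable (h : R -> R) x : derivable h x 1 -> 0 < h x ->
  derivable (fun y => Num.sqrt (h y)) x 1.
Proof.
move=> dh h0.
have [] := @is_derive1_comp _ Num.sqrt h x _ _ (is_derive1_sqrt h0) (derivableP
  dh).
by [].
Qed.

Lemma derivable_scale (k : R) (h : R -> R) x : derivable h x 1 ->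
  derivable (fun y => k * h y) x 1.
Proof. by move=> dh; exact: (derivableM (derivable_cst k x 1) dh). Qed.

Lemma coupling_gt0 (v d : R) : 0 < v -> 0 < d -> 0 < coupling v d.
Proof. by move=> v0 d0; rewrite divr_gt0 ?mulr_gt0. Qed.

Lemma low_period_gt0 c M d f : 0 < c -> 0 <= M -> 0 < d ->
  low_range M d f -> 0 < low_period c M d f.
Proof.
move=> c0 M0 d0 /(low_regime M0 d0)[s0 _ _ _ b0].
by rewrite mulr_gt0// agm_integral_gt0// mulr_gt0// !mulr_gt0.
Qed.

Lemma high_period_gt0 c M d f : 0 < c -> 0 <= M -> 0 < d ->
  high_range M d f -> 0 < high_period c M d f.
Proof.
move=> c0 M0 d0 /(high_regime M0 d0)[_ g0 _ a0 _].
by rewrite mulr_gt0// agm_integral_gt0// mulr_gt0// mulr_gt0.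
Qed.

Lemma low_period_derivable c M d f : 0 < c -> 0 <= M -> 0 < d ->
  low_range M d f -> derivable (low_period c M d) f 1.
Proof.
move=> c0 M0 d0 fr.
have [s0 _ _ _ b0] := low_regime M0 d0 fr.
have D0 : 0 < 4 * M ^+ 2 + d ^+ 2 - 4 * f by rewrite -sqrtr_gt0.
have ds : derivable (root_gap M d) f 1.
  by apply: sqrt_derivable => //; exact: ex_derive.
have dsd : derivable (fun y => root_gap M d y * d) f 1.
  by rewrite (_ : (fun y => _) = (fun y => d * root_gap M d y));
    [exact: derivable_scale|apply/funext => y; rewrite mulrC].
apply: derivable_scale; apply: agm_integral_derivable.
- by do 2 apply: derivable_scale.
- apply: derivable_scale; apply: derivableB.
    apply: derivableD; last exact: derivable_cst.
    exact: derivable_scale.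
  by apply: derivable_scale; exact: derivable_id.
- by rewrite !mulr_gt0.
- by rewrite mulr_gt0.
Qed.

Lemma high_period_derivable c M d f : 0 < c -> 0 <= M -> 0 < d ->
  high_range M d f -> derivable (high_period c M d) f 1.
Proof.
move=> c0 M0 d0 fr.
have [_ g0 _ a0 _] := high_regime M0 d0 fr.
have D0 : 0 < f ^+ 2 - M ^+ 2 * d ^+ 2 by rewrite -sqrtr_gt0.
have dg : derivable (root_mean M d) f 1.
  by apply: sqrt_derivable => //; exact: ex_derive.
apply: derivable_scale; apply: agm_integral_derivable.
- apply: derivable_scale; apply: derivableD.
    apply: derivableB; last exact: derivable_cst.
    by apply: derivable_scale; exact: derivable_id.
  exact: derivable_scale.
- by do 2 apply: derivable_scale.
- by rewrite mulr_gt0.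
- by rewrite !mulr_gt0.
Qed.

Lemma low_period_nondecreasing c M d f1 f2 : 0 < c -> 0 <= M -> 0 < d ->
  low_range M d f1 -> low_range M d f2 -> f1 <= f2 ->
  low_period c M d f1 <= low_period c M d f2.
Proof.
move=> c0 M0 d0 /(low_regime M0 d0)[s1 _ _ _ b1] /(low_regime M0 d0)[s2 _ _ _
  b2] ff.
have ss : root_gap M d f2 <= root_gap M d f1 by rewrite ler_wsqrtr//; lra.
have ssd : root_gap M d f2 * d <= root_gap M d f1 * d by rewrite ler_pM2r.
rewrite ler_pM2l//; apply: le_agm_integral;
  rewrite ?(ler_pM2l c0) ?mulr_gt0 ?mulr_gt0//.
  by rewrite ler_pM2l.
by lra.
Qed.

Lemma root_mean_nondecreasing M d f1 f2 : 0 <= f1 -> f1 <= f2 ->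
  root_mean M d f1 <= root_mean M d f2.
Proof.
by move=> f0 ff; rewrite ler_wsqrtr// lerB// lerXn2r ?nnegrE// (le_trans f0).
Qed.

Lemma high_period_nonincreasing c M d f1 f2 : 0 < c -> 0 <= M -> 0 < d ->
  high_range M d f1 -> high_range M d f2 -> f1 <= f2 ->
  high_period c M d f2 <= high_period c M d f1.
Proof.
move=> c0 M0 d0 /(high_regime M0 d0)[f0 g1 _ a1 _] /(high_regime M0 d0)[_ g2 _
  a2 _] ff.
have gg := @root_mean_nondecreasing M d _ _ (ltW f0) ff.
rewrite ler_pM2l//; apply: le_agm_integral;
  rewrite ?(ler_pM2l c0) ?mulr_gt0 ?mulr_gt0//.
  by lra.
by rewrite ler_pM2l.
Qed.

(** Both arguments increase with M and decrease with f, so that (M, f2) is the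
    smallest and (N, f1) the largest of the four points. *)
Lemma low_period_cross c M N d f1 f2 : 0 < c -> 0 <= M -> M <= N -> 0 < d ->
  low_range M d f1 -> low_range M d f2 ->
  low_range N d f1 -> low_range N d f2 -> f1 <= f2 ->
  low_period c M d f1 * low_period c N d f2 <=
  low_period c M d f2 * low_period c N d f1.
Proof.
move=> c0 M0 MN d0 M1 M2 N1 N2 ff.
have N0 := le_trans M0 MN.
have [sM2 _ _ _ bM2] := low_regime M0 d0 M2.
have MN2 : M ^+ 2 <= N ^+ 2 by rewrite lerXn2r ?nnegrE.
have X0 : 0 < 4 * M ^+ 2 + d ^+ 2 - 4 * f2 by rewrite -sqrtr_gt0.
have s1 : root_gap M d f2 <= root_gap M d f1 by rewrite ler_wsqrtr//; lra.
have s2 : root_gap M d f2 <= root_gap N d f2 by rewrite ler_wsqrtr//; lra.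
have s3 : root_gap M d f2 <= root_gap N d f1 by rewrite ler_wsqrtr//; lra.
have s4 : root_gap M d f2 + root_gap N d f1 <= root_gap M d f1 + root_gap N d
  f2.
  have := @sqrt_submodular _ (4 * M ^+ 2 + d ^+ 2 - 4 * f2) (4 * (f2 - f1))
    (4 * (N ^+ 2 - M ^+ 2)) (ltW X0).
  rewrite /root_gap.
  have -> : 4 * M ^+ 2 + d ^+ 2 - 4 * f2 + 4 * (f2 - f1) + 4 * (N ^+ 2 - M ^+
    2) =
     4 * N ^+ 2 + d ^+ 2 - 4 * f1 by ring.
  have -> : 4 * M ^+ 2 + d ^+ 2 - 4 * f2 + 4 * (f2 - f1) =
     4 * M ^+ 2 + d ^+ 2 - 4 * f1 by ring.
  have -> : 4 * M ^+ 2 + d ^+ 2 - 4 * f2 + 4 * (N ^+ 2 - M ^+ 2) =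
     4 * N ^+ 2 + d ^+ 2 - 4 * f2 by ring.
  by apply; lra.
rewrite /low_period mulrACA [leRHS]mulrACA ler_pM2l//.
move: (root_gap M d f2) (root_gap M d f1) (root_gap N d f2) (root_gap N d f1)
  sM2 bM2 s1 s2 s3 s4 => s22 s21 s12 s11 sM2 bM2 s1 s2 s3 s4.
have t1 : s22 * d <= s21 * d by rewrite ler_pM2r.
have t2 : s22 * d <= s12 * d by rewrite ler_pM2r.
have t3 : s22 * d <= s11 * d by rewrite ler_pM2r.
have t4 : s22 * d + s11 * d <= s21 * d + s12 * d by rewrite -!mulrDl ler_pM2r.
apply: agm_integral_supermodular;
  rewrite -?mulrDr ?(ler_pM2l c0) ?mulr_gt0 ?mulr_gt0//.
all: by lra.
Qed.

(** Both arguments increase with f and decrease with M, so that (N, f1) is the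
    smallest and (M, f2) the largest of the four points. *)
Lemma high_period_cross c M N d f1 f2 : 0 < c -> 0 <= M -> M <= N -> 0 < d ->
  high_range M d f1 -> high_range M d f2 ->
  high_range N d f1 -> high_range N d f2 -> f1 <= f2 ->
  high_period c M d f1 * high_period c N d f2 <=
  high_period c M d f2 * high_period c N d f1.
Proof.
move=> c0 M0 MN d0 M1 M2 N1 N2 ff.
have N0 := le_trans M0 MN.
have [f1_0 gN1 _ aN1 _] := high_regime N0 d0 N1.
have MN2 : M ^+ 2 <= N ^+ 2 by rewrite lerXn2r ?nnegrE.
have MNd : M ^+ 2 * d ^+ 2 <= N ^+ 2 * d ^+ 2 by rewrite ler_wpM2r ?sqr_ge0.
have ff2 : f1 ^+ 2 <= f2 ^+ 2.
  by rewrite lerXn2r// nnegrE ltW// (lt_le_trans f1_0).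
have X0 : 0 < f1 ^+ 2 - N ^+ 2 * d ^+ 2 by rewrite -sqrtr_gt0.
have s1 : root_mean N d f1 <= root_mean M d f1 by rewrite ler_wsqrtr//; lra.
have s2 : root_mean N d f1 <= root_mean N d f2 by rewrite ler_wsqrtr//; lra.
have s3 : root_mean N d f1 <= root_mean M d f2 by rewrite ler_wsqrtr//; lra.
have s4 : root_mean N d f1 + root_mean M d f2 <= root_mean M d f1 + root_mean N
  d f2.
  have := @sqrt_submodular _ (f1 ^+ 2 - N ^+ 2 * d ^+ 2)
    (N ^+ 2 * d ^+ 2 - M ^+ 2 * d ^+ 2) (f2 ^+ 2 - f1 ^+ 2) (ltW X0).
  rewrite /root_mean.
  have -> : f1 ^+ 2 - N ^+ 2 * d ^+ 2 + (N ^+ 2 * d ^+ 2 - M ^+ 2 * d ^+ 2) +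
    (f2 ^+ 2 - f1 ^+ 2) = f2 ^+ 2 - M ^+ 2 * d ^+ 2 by ring.
  have -> : f1 ^+ 2 - N ^+ 2 * d ^+ 2 + (N ^+ 2 * d ^+ 2 - M ^+ 2 * d ^+ 2) =
    f1 ^+ 2 - M ^+ 2 * d ^+ 2 by ring.
  have -> : f1 ^+ 2 - N ^+ 2 * d ^+ 2 + (f2 ^+ 2 - f1 ^+ 2) =
    f2 ^+ 2 - N ^+ 2 * d ^+ 2 by ring.
  by apply; rewrite subr_ge0.
rewrite /high_period mulrACA [leRHS]mulrACA ler_pM2l// [leRHS]mulrC.
move: (root_mean N d f1) (root_mean M d f1) (root_mean N d f2) (root_mean M d
  f2)
  gN1 aN1 s1 s2 s3 s4 => g11 g12 g21 g22 gN1 aN1 s1 s2 s3 s4.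
apply: agm_integral_supermodular;
  rewrite -?mulrDr ?(ler_pM2l c0) ?mulr_gt0 ?mulr_gt0//.
all: by lra.
Qed.

End PeriodMonotonicity.

(** * The periods on a component of the slice *)

Section PeriodsOnComponents.
Context {R : realType}.
Implicit Types (M N d f c x : R).

Lemma tau_minus_low (v M d f : R) : 0 < v -> 0 <= M -> 0 < d ->
  low_range M d f -> tau_minus v M d f = low_period (coupling v d) M d f.
Proof.
move=> v0 M0 d0 /(low_regime M0 d0)[s0 fE s1 s2 _].
exact: tau_minus_split fE s1 s2.
Qed.

Lemma tau_minus_high (v M d f : R) : 0 < v -> 0 <= M -> 0 < d ->
  high_range M d f -> tau_minus v M d f = high_period (coupling v d) M d f.
Proof.
move=> v0 M0 d0 /(high_regime M0 d0)[_ g0 gE a0 q0].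
exact: tau_minus_landen gE a0.
Qed.

Lemma tau_plus_low (v M d f : R) : 0 < v -> 0 <= M -> 0 < d ->
  - M * d < f < M * d ->
  tau_plus v M d f = low_period (coupling v d) M d f.
Proof.
move=> v0 M0 d0 /andP[fl fu].
have fr : low_range M d f.
  by rewrite /low_range fl (lt_le_trans fu)// f_s_ge.
have [s0 fE s1 s2 _] := low_regime M0 d0 fr.
apply: (tau_plus_split v0 d0 fE s1 s2).
move: (root_gap M d f) s0 fE => s s0 fE.
by rewrite ltNge; apply/negP => sle; nra.
Qed.

Lemma tau_plus_high (v M d f : R) : 0 < v -> 0 <= M -> 0 < d ->
  d <= 2 * M -> M * d < f < M ^+ 2 + d ^+ 2 / 4 ->
  tau_plus v M d f = high_period (coupling v d) M d f.
Proof.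
move=> v0 M0 d0 dM /andP[fl fu].
have fr : high_range M d f by rewrite /high_range /f_s dM.
have [_ g0 gE a0 _] := high_regime M0 d0 fr.
have D0 : 0 < 4 * M ^+ 2 + d ^+ 2 - 4 * f by lra.
have s2 : root_gap M d f ^+ 2 = 4 * M ^+ 2 + d ^+ 2 - 4 * f.
  by rewrite sqr_sqrtr// ltW.
have s0 : 0 < root_gap M d f by rewrite sqrtr_gt0.
apply: (tau_plus_landen v0 d0 s0 _ _ g0 gE a0); first by rewrite s2; field.
by rewrite ltNge; apply/negP => sle; nra.
Qed.

Lemma connected_side (C : set R) (p : R) : connected C -> ~ C p ->
  (forall x, C x -> x < p) \/ (forall x, C x -> p < x).
Proof.
move=> /connected_intervalP Ci nCp.
have neq x : C x -> x != p by move=> Cx; apply/eqP => xp; apply: nCp;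
  rewrite -xp.
have [[y [Cy yp]]|H] := pselect (exists y, C y /\ y < p).
  left => x Cx; rewrite lt_neqAle neq//= leNgt; apply/negP => px.
  by apply: nCp; apply: (Ci y x) => //; rewrite !ltW.
right => x Cx; rewrite lt_neqAle eq_sym neq//= leNgt; apply/negP => xp.
by apply: H; exists x.
Qed.

(** The equality T = tau_- is also stated near each point of C, as needed for
    transferring two-sided derivatives. *)
Lemma tau_minus_regime (v M d : R) (C : set R) : 0 < v -> 0 <= M -> 0 < d ->
  (forall f, C f -> - M * d < f) ->
  connected C -> ~ C (f_s M d) ->
  exists T : R -> R, [/\ (forall f, C f -> tau_minus v M d f = T f),
   (forall f, C f -> \forall y \near f, T y = tau_minus v M d y) &
   ((forall f, C f -> low_range M d f) /\ T = low_period (coupling v d) M d) \/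
   ((forall f, C f -> high_range M d f) /\ T = high_period (coupling v d) M d)].
Proof.
move=> v0 M0 d0 Cl Cc nC; have [Cu|Cu] := connected_side Cc nC.
  exists (low_period (coupling v d) M d).
  have lowC f : C f -> low_range M d f by move=> Cf; rewrite /low_range Cl ?Cu.
  split; last by left.
  - by move=> f /lowC; exact: tau_minus_low.
  - move=> f Cf; near=> y; rewrite tau_minus_low//; apply/andP; split; near: y.
      exact/lt_nbhsr/Cl.
    exact/lt_nbhsl/Cu.
exists (high_period (coupling v d) M d).
split; last by right.
- by move=> f /Cu; exact: tau_minus_high.
- move=> f Cf; near=> y; rewrite tau_minus_high//; near: y.
  exact/lt_nbhsr/Cu.
Unshelve. all: by end_near. Qed.

(** Above f_s(M), the bound f_plus excludes d > 2 M: there f_s(M) exceeds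
    f_plus(M), by the inequality of the means. *)
Lemma tau_plus_regime (v M d : R) (C : set R) : 0 < v -> 0 <= M -> 0 < d ->
  (forall f, C f -> - M * d < f < f_plus M d) ->
  connected C -> ~ C (f_s M d) ->
  exists T : R -> R, [/\ (forall f, C f -> tau_plus v M d f = T f),
   (forall f, C f -> \forall y \near f, T y = tau_plus v M d y) &
   ((forall f, C f -> low_range M d f) /\ T = low_period (coupling v d) M d) \/
   ((forall f, C f -> high_range M d f) /\ T = high_period (coupling v d) M d)].
Proof.
move=> v0 M0 d0 Clu Cc nC.
have Cl f : C f -> - M * d < f by case/Clu/andP.
have Cp f : C f -> f < f_plus M d by case/Clu/andP.
have [Cu|Cu] := connected_side Cc nC.
  exists (low_period (coupling v d) M d).
  have Cu' f : C f -> f < M * d.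
    move=> Cf; have := Cu _ Cf; have := Cp _ Cf; rewrite /f_s /f_plus.
    by case: ifP.
  split; last by left; split => // f Cf; rewrite /low_range Cl ?Cu.
  - by move=> f Cf; rewrite tau_plus_low// Cl ?Cu'.
  - move=> f Cf; near=> y; rewrite tau_plus_low//; apply/andP; split; near: y.
      exact/lt_nbhsr/Cl.
    exact/lt_nbhsl/Cu'.
exists (high_period (coupling v d) M d).
have Cu' f : C f -> [/\ d <= 2 * M, M * d < f & f < M ^+ 2 + d ^+ 2 / 4].
  move=> Cf; have := Cu _ Cf; have := Cp _ Cf; rewrite /f_s /f_plus.
  by case: ifP => // _; have := mean_inequality M d; lra.
split; last by right.
- by move=> f /Cu'[? ? ?]; rewrite tau_plus_high//; apply/andP.
- move=> f /Cu'[? ? ?]; near=> y; rewrite tau_plus_high//.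
  by apply/andP; split; near: y; [exact: lt_nbhsr|exact: lt_nbhsl].
Unshelve. all: by end_near. Qed.

End PeriodsOnComponents.

Unset Implicit Arguments.

Theorem theorem1p2 (R : realType) (v0 Mm Mp : R)
  (hv0 : 0 < v0) (hMm : 0 <= Mm) (hMmp : Mm <= Mp)
  (hM : (Mm, Mp) <> (0, 0)) (d : R) (hd : 0 < d) (C : set R)
  (hC : is_component (PP_slice Mm Mp d) C) :
  [/\ derivable_on C (tau_minus v0 Mm d) /\
        weakly_monotone_on C (tau_minus v0 Mm d),
      derivable_on C (tau_plus v0 Mp d) /\
        weakly_monotone_on C (tau_plus v0 Mp d)
    & derivable_on C (omega v0 Mm Mp d) /\
        weakly_monotone_on C (omega v0 Mm Mp d)].
Proof.
have hMp := le_trans hMm hMmp.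
case: hC => x0 _ CE.
have Cc : connected C by rewrite CE; exact: component_connected.
have CP f : C f -> PP_slice Mm Mp d f.
  by rewrite CE; exact: connected_component_sub.
have Cbd f : C f -> f_minus Mm d < f < f_plus Mp d by case/CP.
have nCm : ~ C (f_s Mm d) by case/CP => _ _ /(_ erefl).
have nCp : ~ C (f_s Mp d) by case/CP => _ _ _ /(_ erefl).
have Clm f : C f -> - Mm * d < f by case/Cbd/andP.
have Clp f : C f -> - Mp * d < f < f_plus Mp d.
  move=> /Cbd/andP[fl ->]; rewrite andbT; apply: le_lt_trans fl.
  by rewrite /f_minus ler_wpM2r ?lerN2// ltW.
set c := coupling v0 d; have c0 : 0 < c by exact: coupling_gt0.
have [Tm [TmE Tmn Tmr]] := tau_minus_regime hv0 hMm hd Clm Cc nCm.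
have [Tp [TpE Tpn Tpr]] := tau_plus_regime hv0 hMp hd Clp Cc nCp.
have Tm0 f : C f -> 0 < Tm f.
  move=> Cf; case: Tmr => -[Cr ->];
    [apply: low_period_gt0|apply: high_period_gt0] => //;
  exact: Cr.
have Tp0 f : C f -> 0 < Tp f.
  move=> Cf; case: Tpr => -[Cr ->];
    [apply: low_period_gt0|apply: high_period_gt0] => //;
  exact: Cr.
have dm : derivable_on C (tau_minus v0 Mm d).
  move=> f Cf; apply: near_eq_derivable (Tmn _ Cf) _.
  case: Tmr => -[Cr ->];
    [apply: low_period_derivable|apply: high_period_derivable] => //;
  exact: Cr.
have dp : derivable_on C (tau_plus v0 Mp d).
  move=> f Cf; apply: near_eq_derivable (Tpn _ Cf) _.
  case: Tpr => -[Cr ->];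
    [apply: low_period_derivable|apply: high_period_derivable] => //;
  exact: Cr.
split; split; [exact: dm| |exact: dp| | |].
- case: Tmr => -[Cr TE]; [left|right] => x y; rewrite !inE => Cx Cy xy;
    rewrite !TmE// TE.
    by apply: low_period_nondecreasing => //; exact: Cr.
  by apply: high_period_nonincreasing => //; exact: Cr.
- case: Tpr => -[Cr TE]; [left|right] => x y; rewrite !inE => Cx Cy xy;
    rewrite !TpE// TE.
    by apply: low_period_nondecreasing => //; exact: Cr.
  by apply: high_period_nonincreasing => //; exact: Cr.
- move=> f Cf; apply: (derivableM (dm _ Cf)); apply: derivableV; last exact: dp.
  by rewrite TpE// gt_eqF// Tp0.
- have omegaE f : C f -> omega v0 Mm Mp d f = Tm f / Tp f.
    by move=> Cf; rewrite /omega TmE// TpE.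
  have Tm_ge f : C f -> 0 <= Tm f by move=> /Tm0/ltW.
  (* in all but one of the four cases omega increases *)
  have up : (forall x y, C x -> C y -> x <= y -> Tm x * Tp y <= Tm y * Tp x) ->
      weakly_monotone_on C (omega v0 Mm Mp d).
    move=> H; left => x y; rewrite !inE => Cx Cy xy; rewrite !omegaE//.
    by rewrite ler_pdivrMr ?Tp0// mulrAC ler_pdivlMr ?Tp0// H.
  case: Tmr => -[Cm Em]; case: Tpr => -[Cp Ep].
  + apply: up => x y Cx Cy xy; rewrite Em Ep.
    by apply: low_period_cross => //; [exact: Cm|exact: Cm|exact: Cp|exact: Cp].
  + apply: up => x y Cx Cy xy.
    apply: ler_pM; rewrite ?(ltW (Tm0 _ _)) ?(ltW (Tp0 _ _))//.
      by rewrite Em; apply: low_period_nondecreasing => //; exact: Cm.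
    by rewrite Ep; apply: high_period_nonincreasing => //; exact: Cp.
  + right => x y; rewrite !inE => Cx Cy xy; rewrite !omegaE//.
    rewrite ler_pdivrMr ?Tp0// mulrAC ler_pdivlMr ?Tp0//.
    apply: ler_pM; rewrite ?(ltW (Tm0 _ _)) ?(ltW (Tp0 _ _))//.
      by rewrite Em; apply: high_period_nonincreasing => //; exact: Cm.
    by rewrite Ep; apply: low_period_nondecreasing => //; exact: Cp.
  + apply: up => x y Cx Cy xy; rewrite Em Ep.
    by apply: high_period_cross => //;
      [exact: Cm|exact: Cm|exact: Cp|exact: Cp].
Qed.
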